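(* For all real $b,c>1$, the sets \[ \widetilde{\Xi}'(b,c)=\{z\in\mathfrak{F}: c^{b^n}\le|a_n(z)|\text{ for all }n\in\mathbb{N}\},\qquad \Xi'(b,c)=\{z\in\mathfrak{F}: c^{b^n}\le|a_n(z)|\text{ for infinitely many }n\in\mathbb{N}\} \] satisfy $\dim_H\widetilde{\Xi}'(b,c)=\dim_H\Xi'(b,c)=\frac{2}{1+b}$.
   Context: For $z\in\mathbb{C}$ let $[z]:=\lfloor \Re z+\tfrac12\rfloor+i\lfloor \Im z+\tfrac12\rfloor$ and $\mathfrak{F}:=\{z\in\mathbb{C}:[z]=0\}$. The complex Gauss map is $T(z)=z^{-1}-[z^{-1}]$ ($z\ne0$), $T(0)=0$, and the Hurwitz continued fraction partial quotients of $z$ are $a_1(z)=[z^{-1}]$, $a_n(z)=a_1(T^{n-1}(z))$ (defined while $T^{n-1}(z)\neq 0$). $\dim_H$ is Hausdorff dimension. *)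

(* Defs.v *)
From mathcomp Require Export all_boot all_order all_algebra.
From mathcomp Require Export all_classical all_reals all_analysis.
From mathcomp Require Export complex.

Set Implicit Arguments.
Unset Strict Implicit.
Unset Printing Implicit Defensive.

Import Order.TTheory GRing.Theory Num.Theory.
Export ComplexField.Normc.

Local Open Scope classical_set_scope.
Local Open Scope ring_scope.
Local Open Scope complex_scope.

Section HausdorffDimension.
Context {R : realType}.
Implicit Types (A U : set R[i]) (s delta : R).

(* Supremum of |x - y| over U, in terms of [normc] rather than `|_| because the
   norm of R[i] is R[i]-valued; the value at set0 is -oo. *)
Definition diam U : \bar R :=
  ereal_sup [set d | exists2 x, U x & exists2 y, U y & d = (normc (x - y))%:E].

(* |U|^s, where the empty set counts for 0 for every s, including s = 0, so
   that a finite cover can be padded into a sequence. *)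
Definition gauge s U : \bar R :=
  if U == set0 then 0%E else (diam U `^ s)%E.

Definition delta_cover delta A (U : nat -> set R[i]) : Prop :=
  A `<=` \bigcup_k U k /\ forall k, (diam (U k) <= delta%:E)%E.

Definition hausdorff_content delta s A : \bar R :=
  ereal_inf [set (\sum_(0 <= k <oo) gauge s (U k))%E | U in delta_cover delta A].

(* The limit as delta tends to 0+ is a supremum, the content being
   nonincreasing in delta. *)
Definition hausdorff_measure s A : \bar R :=
  ereal_sup [set hausdorff_content delta s A | delta in [set delta | 0 < delta]].

Definition hausdorff_dim A : \bar R :=
  ereal_inf [set s%:E | s in [set s | 0 <= s /\ hausdorff_measure s A = 0%E]].

End HausdorffDimension.

Section HurwitzContinuedFraction.
Context {R : realType}.
Implicit Types z : R[i].

Definition nearest_gauss z : R[i] :=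
  (Num.floor (complex.Re z + 2^-1))%:~R +i* (Num.floor (complex.Im z + 2^-1))%:~R.

Definition fundamental_domain : set R[i] := [set z | nearest_gauss z = 0].

Definition gauss_map z : R[i] :=
  if z == 0 then 0 else z^-1 - nearest_gauss z^-1.

Definition hcf_first z : R[i] := nearest_gauss z^-1.

(* Partial quotients are indexed from 1. *)
Definition hcf_quotient (n : nat) z : R[i] :=
  hcf_first (iter n.-1 gauss_map z).

Definition hcf_defined (n : nat) z : Prop := iter n.-1 gauss_map z != 0.

Definition large_quotient (b c : R) (n : nat) z : Prop :=
  hcf_defined n z /\ c `^ (b ^+ n) <= normc (hcf_quotient n z).

Definition Xi_all (b c : R) : set R[i] :=
  [set z | fundamental_domain z /\
     forall n, (0 < n)%N -> large_quotient b c n z].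

Definition Xi_io (b c : R) : set R[i] :=
  [set z | fundamental_domain z /\
     infinite_set [set n | (0 < n)%N /\ large_quotient b c n z]].

End HurwitzContinuedFraction.

(* Main.v *)
Require Import Defs.
From mathcomp Require Import ring lra zify.

(* Upper bound.  Put |g| ~ gsize(g) for the size of a digit g and v_n for the
   logarithm of the product of the first n sizes.  If a_n >= c^(b^n) infinitely
   often and 1 < B < b, then v_n / B^n is unbounded, so at infinitely many n it
   sets a record: v_(n+1) >= B v_n, and v_(n+1) >= L (n+1) for any fixed L.  For
   a word w of length n, the points with first digits w and these two
   properties form a set of diameter at most
     C^n exp(-(1 + kappa) v_n / 2 - theta L n / 2)
   with kappa < B as close to B as wanted.  When s > 2/(1+b) the power
   p = s (1 + kappa) / 2 can be taken > 1, so the s-th powers of the diameters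
   sum over all words of length n to at most (C M exp(-theta s L / 2))^n, where
   M is the sum of gsize^(-p) over the Gaussian integers; for L large this is at
   most 2^-n.

   Lower bound.  Take the n-th digit in a square box of side
   r_n ~ c^(b^(n+1)) at distance r_n from the origin.  All such sequences are
   admissible and distances between the resulting points are controlled from
   below by the digits.  A set of diameter D between two consecutive scales
   meets a proportion O(D^s) of the cylinders of some level, for any
   s < 2/(1+b).  If a cover had small total D^s, one could choose digits one by
   one keeping the total proportion of met descendants below 1, and the limit
   point would avoid every set of the cover. *)

Set Implicit Arguments.
Unset Strict Implicit.
Unset Printing Implicit Defensive.

Import Order.TTheory GRing.Theory Num.Theory.

Local Open Scope classical_set_scope.
Local Open Scope ring_scope.
Local Open Scope complex_scope.

(** * Modulus and the Hurwitz map *)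


Section ComplexModulus.
Context {R : realType}.
Implicit Types z w : R[i].

Lemma normcD_le z w : normc (z + w) <= normc z + normc w.
Proof. exact: le_normcD. Qed.

Lemma normc_opp z : normc (- z) = normc z.
Proof. exact: normcN. Qed.

Lemma normcB_le z w : normc (z - w) <= normc z + normc w.
Proof. by rewrite -(normc_opp w) normcD_le. Qed.

Lemma normc_ge0 z : 0 <= normc z.
Proof. by case: z => x y; exact: sqrtr_ge0. Qed.

Lemma normc_gt0 z : (0 < normc z) = (z != 0).
Proof.
rewrite lt_neqAle normc_ge0 andbT eq_sym; congr negb.
by apply/eqP/eqP => [/eq0_normc //|->]; exact: normc0.
Qed.

Lemma normc_sqr z : normc z ^+ 2 = complex.Re z ^+ 2 + complex.Im z ^+ 2.
Proof. by case: z => x y /=; rewrite sqr_sqrtr // addr_ge0 ?sqr_ge0. Qed.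

Lemma normcD_ge z w : normc z - normc w <= normc (z + w).
Proof. by rewrite lerBlDr -{1}(addrK w z) normcB_le. Qed.

Lemma normRe_le_normc z : `|complex.Re z| <= normc z.
Proof.
rewrite -(@ler_pXn2r _ 2) ?nnegrE ?normr_ge0 ?normc_ge0 //.
by rewrite normc_sqr real_normK ?num_real // lerDl sqr_ge0.
Qed.

Lemma normIm_le_normc z : `|complex.Im z| <= normc z.
Proof.
rewrite -(@ler_pXn2r _ 2) ?nnegrE ?normr_ge0 ?normc_ge0 //.
by rewrite normc_sqr real_normK ?num_real // lerDr sqr_ge0.
Qed.

Lemma normc_le_ReIm z : normc z <= `|complex.Re z| + `|complex.Im z|.
Proof.
rewrite -(@ler_pXn2r _ 2) ?nnegrE ?addr_ge0 ?normc_ge0 //.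
rewrite normc_sqr sqrrD !real_normK ?num_real //.
by rewrite addrAC lerDl mulrn_wge0 // mulr_ge0.
Qed.

Lemma normc_inv_sub z w : z != 0 -> w != 0 ->
  normc (z^-1 - w^-1) = normc (z - w) / (normc z * normc w).
Proof.
move=> z0 w0.
have -> : z^-1 - w^-1 = - (z - w) * (z * w)^-1 by field; rewrite z0 w0.
by rewrite normcM normc_opp normcV normcM.
Qed.

End ComplexModulus.

Section HurwitzMap.
Context {R : realType}.
Implicit Types z w : R[i].

Definition gaussc (g : int * int) : R[i] := g.1%:~R +i* g.2%:~R.

Definition digit z : int * int :=
  (Num.floor (complex.Re z + 2^-1), Num.floor (complex.Im z + 2^-1)).

Lemma nearest_gaussE z : nearest_gauss z = gaussc (digit z).
Proof. by []. Qed.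

Lemma fundamental_domainE z : fundamental_domain z <->
  (- 2^-1 <= complex.Re z < 2^-1) /\ (- 2^-1 <= complex.Im z < 2^-1).
Proof.
have fl (x : R) : (Num.floor (x + 2^-1))%:~R = 0 :> R <-> - 2^-1 <= x < 2^-1.
  split=> [/eqP|/andP[x1 x2]].
    rewrite intr_eq0 => /eqP x0.
    have := floor_itv (x + 2^-1); rewrite x0 add0r mulr0z mulr1z.
    by move=> /andP[? ?]; apply/andP; split; lra.
  suff -> : Num.floor (x + 2^-1) = 0 by [].
  by apply/floor_def; rewrite mulr0z add0r mulr1z; apply/andP; split; lra.
rewrite /fundamental_domain /nearest_gauss /=; split.
  by move=> /eqP; rewrite eq_complex /= => /andP[/eqP/fl ? /eqP/fl ?].
move=> [/fl h1 /fl h2].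
by apply/eqP; rewrite eq_complex /= h1 h2 !eqxx.
Qed.

Lemma fundamental_domain_small z : normc z < 2^-1 -> fundamental_domain z.
Proof.
move=> zlt; apply/fundamental_domainE.
have := le_lt_trans (normRe_le_normc z) zlt.
have := le_lt_trans (normIm_le_normc z) zlt.
by rewrite !ltr_norml => /andP[/ltW -> ->] /andP[/ltW -> ->].
Qed.

Lemma normc_fundamental z : fundamental_domain z -> normc z ^+ 2 <= 2^-1.
Proof.
move=> /fundamental_domainE[/andP[? ?] /andP[? ?]]; rewrite normc_sqr; nra.
Qed.

Lemma digit_gaussD g w : fundamental_domain w -> digit (gaussc g + w) = g.
Proof.
case: g => x y; case: w => u v /fundamental_domainE[/= /andP[? ?] /andP[? ?]].
by congr pair; apply/floor_def; rewrite /= rmorphD /= mulr1z;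
  apply/andP; split; lra.
Qed.

Lemma fundamental_domain_gauss_map z : fundamental_domain (gauss_map z).
Proof.
rewrite /gauss_map; case: eqP => [_|_].
  by apply: fundamental_domain_small; rewrite normc0 invr_gt0.
apply/fundamental_domainE; case: (z^-1) => x y /=.
have := floor_itv (x + 2^-1); have := floor_itv (y + 2^-1).
rewrite !rmorphD /= !mulr1z => /andP[? ?] /andP[? ?].
by split; apply/andP; split; lra.
Qed.

Lemma fundamental_domain_iter n z :
  fundamental_domain z -> fundamental_domain (iter n gauss_map z).
Proof. by case: n => //= n _; exact: fundamental_domain_gauss_map. Qed.

Lemma inv_gauss_map z : z != 0 -> z^-1 = gaussc (digit z^-1) + gauss_map z.
Proof. by move=> z0; rewrite /gauss_map (negbTE z0) nearest_gaussE addrC subrK. Qed.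

Lemma gauss_map_inv g w : gaussc g + w != 0 -> fundamental_domain w ->
  gauss_map (gaussc g + w)^-1 = w.
Proof.
move=> gw0 Fw; rewrite /gauss_map invr_eq0 (negbTE gw0) invrK nearest_gaussE.
by rewrite digit_gaussD // addrC addKr.
Qed.

Lemma normc_fundamental_lt1 z : fundamental_domain z -> normc z < 1.
Proof.
move=> /normc_fundamental zle; have := normc_ge0 z; nra.
Qed.

(* Lies between |x+iy| and 4 |x+iy|^2 for nonzero x+iy; being a product, it
   makes sums over the Gaussian integers factor. *)
Definition gsize (g : int * int) : R := (1 + `|g.1|%:~R) * (1 + `|g.2|%:~R).

Lemma gsize_ge1 g : 1 <= gsize g.
Proof.
have h (m : int) : 1 <= 1 + `|m|%:~R :> R by rewrite lerDl ler0z.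
by rewrite -[leLHS]mulr1; apply: ler_pM.
Qed.

Lemma normc_gaussc_le g : normc (gaussc g) <= gsize g.
Proof.
apply: (le_trans (normc_le_ReIm _)); rewrite /= /gsize -!intr_norm.
have : 0 <= `|g.1|%:~R :> R by rewrite ler0z.
have : 0 <= `|g.2|%:~R :> R by rewrite ler0z.
nra.
Qed.

Lemma gsize_le_normc g : gaussc g != 0 -> gsize g <= 4 * normc (gaussc g) ^+ 2.
Proof.
case: g => x y g0; rewrite normc_sqr /gsize /=.
have h (m : int) : (`|m|%:~R : R) ^+ 2 = m%:~R ^+ 2.
  by rewrite intr_norm real_normK // num_real.
rewrite -(h x) -(h y).
have x0 : 0 <= `|x|%:~R :> R by rewrite ler0z.
have y0 : 0 <= `|y|%:~R :> R by rewrite ler0z.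
have : 1 <= `|x|%:~R :> R \/ 1 <= `|y|%:~R :> R.
  have [xE|xn0] := eqVneq x 0; last first.
    by left; rewrite ler1z -gtz0_ge1 normr_gt0.
  have [yE|yn0] := eqVneq y 0; last first.
    by right; rewrite ler1z -gtz0_ge1 normr_gt0.
  by move: g0; rewrite /gaussc xE yE /= eqxx.
move: x0 y0; set u := `|x|%:~R; set v := `|y|%:~R => u0 v0 uv.
have uv0 := mulr_ge0 u0 v0.
case: uv => h1; nra.
Qed.

Lemma normc_gsize_digit z : fundamental_domain z -> z != 0 ->
  normc z ^+ 2 <= 16 / gsize (digit z^-1).
Proof.
move=> Fz z0.
have zE := inv_gauss_map z0.
have Fz' := fundamental_domain_gauss_map z.
have n0 : 0 < normc z by rewrite normc_gt0.
have n1 := normc_fundamental_lt1 Fz.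
have n1' := normc_fundamental_lt1 Fz'.
set g := digit z^-1 in zE *.
have z1 : 1 < normc z^-1 by rewrite normcV invf_gt1.
have g0 : gaussc g != 0.
  apply: contraTneq z1 => g0; rewrite zE g0 add0r -leNgt; exact: ltW.
have gle : normc (gaussc g) <= 2 * (normc z)^-1.
  have -> : gaussc g = z^-1 - gauss_map z by rewrite zE addrK.
  apply: (le_trans (normcB_le _ _)); rewrite -normcV; lra.
have := gsize_le_normc g0; have := gsize_ge1 g.
move: (gsize g) => s s1 sle.
rewrite ler_pdivlMr ?(lt_le_trans ltr01) //.
have h : normc z * normc (gaussc g) <= 2.
  by rewrite mulrC -ler_pdivlMr.
have := normc_ge0 (gaussc g); move: (normc (gaussc g)) h sle => N h sle N0.
apply: (le_trans (ler_wpM2l (sqr_ge0 _) sle)).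
rewrite mulrCA -exprMn -[leRHS]/(16%:R).
have : 0 <= normc z * N by rewrite mulr_ge0 // ltW.
nra.
Qed.

End HurwitzMap.

(** * Sums over words of Gaussian integers *)


Section FiniteSums.
Context {R : realType}.

Lemma ler_sum_uniq_sub (T : eqType) (A B : seq T) (f : T -> R) :
  uniq A -> uniq B -> {subset A <= B} -> (forall x, 0 <= f x) ->
  \sum_(x <- A) f x <= \sum_(x <- B) f x.
Proof.
move=> uA uB AB f0.
have AE : perm_eq A [seq x <- B | x \in A].
  apply: uniq_perm => //; first exact: filter_uniq.
  move=> x; rewrite mem_filter; case: (boolP (x \in A)) => //= /AB ->.
  by [].
by rewrite (perm_big _ AE) big_filter big_mkcond; apply: ler_sum => x _; case: ifP.
Qed.

Fixpoint words (T : Type) (S : seq T) (n : nat) : seq (seq T) :=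
  if n is m.+1 then [seq a :: w | a <- S, w <- words S m] else [:: [::]].

Lemma uniq_words (T : eqType) (S : seq T) n : uniq S -> uniq (words S n).
Proof.
move=> uS; elim: n => //= n IH; apply: allpairs_uniq => //.
by move=> [a v] [a' v'] _ _ /= [-> ->].
Qed.

Lemma mem_words (T : eqType) (S : seq T) n w :
  size w = n -> {subset w <= S} -> w \in words S n.
Proof.
elim: n w => [|n IH] [|a w] //= [sw] wS.
apply/allpairsP; exists (a, w) => /=; split => //.
  by apply: wS; rewrite mem_head.
by apply: IH => // x xw; apply: wS; rewrite inE xw orbT.
Qed.

Lemma sum_words (T : Type) (S : seq T) n (f : T -> R) :
  \sum_(w <- words S n) \prod_(a <- w) f a = (\sum_(a <- S) f a) ^+ n.
Proof.
elim: n => [|n IH] /=; first by rewrite big_seq1 big_nil expr0.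
rewrite big_allpairs_dep /= exprS big_distrl /=; apply: eq_bigr => a _.
by rewrite -IH big_distrr /=; apply: eq_bigr => w _; rewrite big_cons.
Qed.

Lemma sum_words_geometric (T : choiceType) (f : T -> R) (N : nat) (W : seq (seq T)) :
  (forall a, 0 <= f a) ->
  (forall S, uniq S -> \sum_(a <- S) f a <= 2^-1) ->
  uniq W -> (forall w, w \in W -> N <= size w)%N ->
  \sum_(w <- W) \prod_(a <- w) f a <= 2 * 2^-1 ^+ N.
Proof.
move=> f0 f1 uW WN.
have F0 (w : seq T) : 0 <= \prod_(a <- w) f a by apply: prodr_ge0.
pose S := undup (flatten W).
pose L := \max_(w <- W) (size w).+1.
have -> : \sum_(w <- W) \prod_(a <- w) f a =
    \sum_(N <= n < L) \sum_(w <- [seq w <- W | size w == n]) \prod_(a <- w) f a.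
  under [RHS]eq_bigr do rewrite big_filter big_mkcond.
  rewrite exchange_big /= big_seq [RHS]big_seq; apply: eq_bigr => w wW.
  rewrite -big_mkcond /=; rewrite (eq_bigl (fun n => n == size w)) => [|n]; last exact: eq_sym.
  by rewrite big_nat1_eq WN //= /L (bigmaxn_sup_seq _ wW).
have h n : \sum_(w <- [seq w <- W | size w == n]) \prod_(a <- w) f a <= 2^-1 ^+ n.
  apply: (@le_trans _ _ (\sum_(w <- words S n) \prod_(a <- w) f a)).
    apply: ler_sum_uniq_sub => //; [exact: filter_uniq|exact/uniq_words/undup_uniq|].
    move=> w; rewrite mem_filter => /andP[/eqP sw wW]; apply: mem_words => // a aw.
    by rewrite mem_undup; apply/flattenP; exists w.
  rewrite sum_words; apply: lerXn2r; rewrite ?nnegrE ?invr_ge0 ?sumr_ge0 //.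
  exact/f1/undup_uniq.
apply: (le_trans (ler_sum _ (fun n _ => h n))).
have [NL|LN] := leqP N L; last first.
  by rewrite big_geq ?mulr_ge0 ?exprn_ge0 // ltnW.
suff : \sum_(N <= n < L) (2^-1 : R) ^+ n <= 2 * 2^-1 ^+ N - 2 * 2^-1 ^+ L.
  move/le_trans; apply; rewrite gerBl mulr_ge0 ?exprn_ge0 //.
elim: L NL => [|L IH]; first by rewrite leqn0 => /eqP ->; rewrite big_geq // subrr.
rewrite leq_eqVlt => /predU1P[->|]; first by rewrite big_geq // subrr.
rewrite ltnS => NL; rewrite big_nat_recr //= exprS.
have := IH NL; lra.
Qed.

(* Telescoping: 1 + q x <= (1 - x)^(-q) gives
   q (k+2)^(-q-1) <= (k+1)^(-q) - (k+2)^(-q). *)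
Lemma sum_inv_powR_le (q : R) (n : nat) : 0 < q ->
  \sum_(0 <= k < n) k.+1%:R `^ (- (1 + q)) <= 1 + q^-1.
Proof.
move=> q0.
case: n => [|n]; first by rewrite big_geq // addr_ge0 // invr_ge0 ltW.
suff : \sum_(0 <= k < n.+1) k.+1%:R `^ (- (1 + q)) <=
    1 + q^-1 - q^-1 * n.+1%:R `^ (- q).
  by move/le_trans; apply; rewrite gerBl mulr_ge0 ?powR_ge0 // invr_ge0 ltW.
elim: n => [|n IH]; first by rewrite big_nat1 !powR1 mulr1 addrK.
rewrite big_nat_recr //=; apply: (le_trans (lerD IH (lexx _))).
set u : R := n.+1%:R; set v : R := n.+2%:R.
have u0 : 0 < u by [].
have v0 : 0 < v by [].
have uv : u = v * (1 - v^-1).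
  by rewrite mulrBr mulr1 divff ?gt_eqF // /u /v -[n.+2]addn1 natrD addrK.
have w0 : 0 < 1 - v^-1 by rewrite -(pmulr_rgt0 _ v0) -uv.
have -> : u `^ (- q) = v `^ (- q) * (1 - v^-1) `^ (- q).
  by rewrite uv powRM // ltW.
have -> : v `^ (- (1 + q)) = v `^ (- q) * v^-1.
  rewrite -[v^-1]powR_inv1 ?ltW // -powRD; last by rewrite (gt_eqF v0) implybT.
  by rewrite opprD addrC.
have : 1 + q * v^-1 <= (1 - v^-1) `^ (- q).
  rewrite /powR gt_eqF //; apply: (le_trans _ (expR_ge1Dx _)).
  rewrite lerD2l mulNr -mulrN ler_pM2l // lerNr.
  by apply: (le_trans (le_ln1Dx _)) => //; rewrite ltrN2 invf_lt1 ?ltr1n.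
move: (_ `^ _) (powR_ge0 v (- q)) => a a0; move: (_ `^ _) => c hc.
have qi : 0 < q^-1 by rewrite invr_gt0.
have := ler_wpM2l (mulr_ge0 (ltW qi) a0) hc.
have -> : q^-1 * a * (1 + q * v^-1) = q^-1 * a + a * v^-1.
  rewrite mulrDr mulr1; congr (_ + _); field; rewrite !gt_eqF //.
rewrite mulrA; move: (q^-1 * a * c) (q^-1 * a) (a * v^-1) => x y z; lra.
Qed.

Lemma sum_int_powR_le (q : R) (X : seq int) : 0 < q -> uniq X ->
  \sum_(x <- X) (1 + `|x|%:~R) `^ (- (1 + q)) <= 2 * (1 + q^-1).
Proof.
move=> q0 uX.
pose n := \max_(x <- X) (absz x).+1.
have Xn x : x \in X -> (absz x < n)%N.
  by move=> xX; rewrite /n (bigmaxn_sup_seq _ xX).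
pose Y := [seq Posz i | i <- iota 0 n] ++ [seq Negz i | i <- iota 0 n].
apply: (@le_trans _ _ (\sum_(x <- Y) (1 + `|x|%:~R) `^ (- (1 + q)))).
  apply: ler_sum_uniq_sub => //.
  - rewrite cat_uniq !map_inj_uniq ?iota_uniq //=; try by move=> ? ? [].
    by rewrite andbT; apply/hasPn => x /mapP[i _ ->]; apply/mapP => -[].
  - move=> x /Xn; rewrite /Y mem_cat; case: x => i /= ni; apply/orP.
      by left; apply/mapP; exists i; rewrite // mem_iota.
    by right; apply/mapP; exists i; rewrite // mem_iota add0n /= ltnW.
rewrite /Y big_cat !big_map mulr_natl mulr2n; apply: lerD.
  apply: (le_trans _ (sum_inv_powR_le n q0)).
  rewrite /index_iota subn0 le_eqVlt; apply/orP; left; apply/eqP.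
  by apply: eq_bigr => i _; rewrite /= -natr1 addrC.
apply: (le_trans _ (sum_inv_powR_le n q0)).
rewrite /index_iota subn0; apply: ler_sum => i _.
have -> : `|Negz i|%:~R = i.+1%:R :> R by [].
rewrite !powRN lef_pV2 ?posrE ?powR_gt0 // ?ltr_wpDl //.
by apply: ge0_ler_powR; rewrite ?nnegrE ?addr_ge0 ?(ltW q0) // lerDr.
Qed.

Lemma sum_gsize_powR_le (p : R) (S : seq (int * int)) : 1 < p -> uniq S ->
  \sum_(g <- S) gsize g `^ (- p) <= (2 * (1 + (p - 1)^-1)) ^+ 2.
Proof.
move=> p1 uS; pose F (x : int) : R := (1 + `|x|%:~R) `^ (- p).
have FE X : uniq X -> \sum_(x <- X) F x <= 2 * (1 + (p - 1)^-1).
  move=> uX; rewrite /F -{1}(subrK 1 p) (addrC _ 1).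
  by apply: sum_int_powR_le => //; rewrite subr_gt0.
pose X := undup (unzip1 S); pose Y := undup (unzip2 S).
apply: (@le_trans _ _ (\sum_(g <- [seq (x, y) | x <- X, y <- Y]) gsize g `^ (- p))).
  apply: ler_sum_uniq_sub => //.
    by apply: allpairs_uniq => [||[? ?] [? ?]//]; exact: undup_uniq.
  move=> [x y] gS; apply/allpairsP; exists (x, y); split => //=;
  by rewrite mem_undup; apply/mapP; exists (x, y).
  by move=> x; exact: powR_ge0.
rewrite big_allpairs /=.
have h (x : int) : 0 <= 1 + `|x|%:~R :> R by rewrite addr_ge0 // ler0z.
under eq_bigr => x _ do under eq_bigr => y _ do rewrite /gsize /= powRM //.
rewrite [X in X <= _](_ : _ = (\sum_(x <- X) F x) * (\sum_(y <- Y) F y)); last first.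
  by rewrite big_distrl /=; apply: eq_bigr => x _; rewrite big_distrr.
rewrite expr2; apply: ler_pM; rewrite ?sumr_ge0 ?FE ?undup_uniq //;
  by move=> *; exact: powR_ge0.
Qed.

End FiniteSums.

(** * Hausdorff measure *)


Section HausdorffFacts.
Context {R : realType}.
Implicit Types (A U : set R[i]) (s : R).

Lemma gauge_ge0 s U : (0 <= gauge s U)%E.
Proof. by rewrite /gauge; case: ifP => // _; exact: poweR_ge0. Qed.

Lemma diam_ge0 U : U !=set0 -> (0 <= diam U)%E.
Proof.
move=> [x Ux]; apply: le_ereal_sup_tmp; exists 0%E => //.
by exists x => //; exists x => //; rewrite subrr normc0.
Qed.

Lemma gauge_le s U (D h : R) : 0 <= s -> 0 <= D -> 0 <= h ->
  (forall x y, U x -> U y -> normc (x - y) <= D) -> D `^ s <= h ->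
  (gauge s U <= h%:E)%E.
Proof.
move=> s0 D0 h0 UD Dh; rewrite /gauge; case: ifPn => [_|/set0P U0].
  by rewrite lee_fin.
apply: (@le_trans _ _ (D%:E `^ s)%E); last by rewrite poweR_EFin lee_fin.
have dD : (diam U <= D%:E)%E.
  by apply/ereal_supP => _ [x Ux [y Uy ->]]; rewrite lee_fin UD.
by apply: gt0_ler_poweR; rewrite // in_itv /= ?leey ?andbT ?lee_fin ?diam_ge0.
Qed.

Lemma gauge_gt s U (d : R) : 0 < s -> 0 <= d -> (d%:E < diam U)%E ->
  ((d `^ s)%:E < gauge s U)%E.
Proof.
move=> s0 d0 dU; rewrite /gauge; case: ifPn => [/eqP U0|/set0P U0].
  by move: dU; rewrite U0 /diam (_ : [set _ | _] = set0) ?ereal_sup0 ?ltNge ?leNye//;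
    rewrite -subset0 => ? [x []].
case: (diam U) dU (diam_ge0 U0) => [e||//].
  rewrite poweR_EFin !lte_fin lee_fin => de e0.
  by apply: gt0_ltr_powR; rewrite ?nnegrE.
by rewrite poweRyr ?ltry // gt_eqF.
Qed.

Lemma hausdorff_content_ge0 (delta : R) s A : (0 <= hausdorff_content delta s A)%E.
Proof.
apply/ereal_infP => _ [U _ <-]; apply: nneseries_ge0 => k _ _; exact: gauge_ge0.
Qed.

(* For s > 0 a small total gauge forces every member of the cover to be small. *)
Lemma hausdorff_measure_eq0 s A : 0 < s ->
  (forall e : R, 0 < e -> exists U : nat -> set R[i],
     A `<=` \bigcup_k U k /\ (\sum_(0 <= k <oo) gauge s (U k) <= e%:E)%E) ->
  hausdorff_measure s A = 0%E.
Proof.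
move=> s0 cov; apply/eqP; rewrite eq_le; apply/andP; split; last first.
  apply: le_ereal_sup_tmp; exists (hausdorff_content 1 s A).
    by exists 1 => //=; rewrite ltr01.
  exact: hausdorff_content_ge0.
apply/ereal_supP => _ [d d0 <-]; apply/lee_addgt0Pr => e e0; rewrite add0e.
have ds0 : 0 < d `^ s by exact: powR_gt0.
have m0 : 0 < Num.min e (d `^ s) by rewrite lt_min e0.
have [U [AU sU]] := cov _ m0.
apply: ge_ereal_inf; exists (\sum_(0 <= k <oo) gauge s (U k))%E; last first.
  by apply: (le_trans sU); rewrite lee_fin ge_min lexx.
exists U => //; split => // k; rewrite leNgt; apply/negP => dk.
have := gauge_gt s0 (ltW d0) dk; apply/negP; rewrite -leNgt.
have gU n : (0 <= gauge s (U n))%E by exact: gauge_ge0.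
apply: (@le_trans _ _ (\sum_(0 <= k <oo) gauge s (U k))%E).
  apply: (le_trans _ (nneseries_lim_ge k.+1 _)) => //.
  by rewrite big_nat_recr //= leeDr // sume_ge0.
by apply: (le_trans sU); rewrite lee_fin ge_min lexx orbT.
Qed.

Lemma hausdorff_measure_eq0_sub s A B : 0 <= s -> A `<=` B ->
  hausdorff_measure s B = 0%E -> hausdorff_measure s A = 0%E.
Proof.
move=> s0 AB HB; apply/eqP; rewrite eq_le; apply/andP; split; last first.
  apply: le_ereal_sup_tmp; exists (hausdorff_content 1 s A).
    by exists 1 => //=; rewrite ltr01.
  exact: hausdorff_content_ge0.
rewrite -HB; apply/ereal_supP => _ [d d0 <-]; apply: le_ereal_sup_tmp.
exists (hausdorff_content d s B); first by exists d.
apply: ereal_inf_le_tmp => _ [U [BU Ud] <-]; exists U => //.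
by split => //; exact: subset_trans BU.
Qed.

Lemma hausdorff_measure0_cover s A (delta e : R) : 0 < delta -> 0 < e ->
  hausdorff_measure s A = 0%E ->
  exists U : nat -> set R[i], delta_cover delta A U /\
    (\sum_(0 <= k <oo) gauge s (U k) < e%:E)%E.
Proof.
move=> d0 e0 H0.
have c0 : hausdorff_content delta s A = 0%E.
  apply/eqP; rewrite eq_le hausdorff_content_ge0 andbT -H0.
  by apply: le_ereal_sup_tmp; exists (hausdorff_content delta s A) => //; exists delta.
have [|_ [U AU <-]] := lb_ereal_inf_adherent (S := [set (\sum_(0 <= k <oo) gauge s (U k))%E | U in delta_cover delta A]) e0.
  by rewrite -/(hausdorff_content delta s A) c0.
by rewrite -/(hausdorff_content delta s A) c0 add0e => sU; exists U.
Qed.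

End HausdorffFacts.

Section Growth.
Context {R : realType}.

Lemma bernoulli (x : R) n : 0 <= x -> 1 + n%:R * x <= (1 + x) ^+ n.
Proof.
move=> x0; elim: n => [|n IH]; first by rewrite mul0r addr0 expr0.
rewrite exprS; apply: (@le_trans _ _ ((1 + x) * (1 + n%:R * x))).
  have : 0 <= n%:R :> R by []; rewrite -[n.+1]addn1 natrD; nra.
by rewrite ler_wpM2l // addr_ge0.
Qed.

Lemma linear_le_expn (B L : R) : 1 < B ->
  exists K : R, forall n, L * n%:R <= B ^+ n + K.
Proof.
move=> B1; have B0 : 0 <= B by rewrite ltW // (lt_trans _ B1).
set s := Num.sqrt B; have sE : B = s ^+ 2 by rewrite sqr_sqrtr.
have s1 : 1 < s by have := sqrtr_ge0 B; rewrite -/s => s0; nra.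
set t := s - 1; have t0 : 0 < t by rewrite subr_gt0.
exists ((L / (2 * t)) ^+ 2) => n.
have h : n%:R * t <= s ^+ n.
  have := @bernoulli t n (ltW t0); rewrite (addrC 1 t) /t subrK; lra.
rewrite sE exprAC.
have n0 : 0 <= n%:R :> R by [].
have : L * n%:R = 2 * (n%:R * t) * (L / (2 * t)) by field; lra.
have : 0 <= n%:R * t by rewrite mulr_ge0 // ltW.
move: (L / _) (n%:R * t) (s ^+ n) h => l x y xy x0 ->.
have := sqr_ge0 (x - l); nra.
Qed.

Lemma linear_le_expn_eventually (B L : R) : 1 < B ->
  exists N : nat, forall n, (N <= n)%N -> L * n%:R <= B ^+ n.
Proof.
move=> /(linear_le_expn (L + 1))[K HK].
exists (Num.truncn `|K|).+1 => n Nn; have := HK n.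
have : K <= n%:R.
  apply: (le_trans (ler_norm _)); apply: (le_trans (ltW (truncnS_gt _))).
  by rewrite ler_nat.
lra.
Qed.

Lemma infinite_nat_ge (A : set nat) N : infinite_set A -> exists2 n, A n & (N <= n)%N.
Proof.
move=> infA; apply: contrapT => h; apply: infA.
apply: (sub_finite_set _ (finite_II N)) => n An /=.
by rewrite ltnNge; apply/negP => Nn; apply: h; exists n.
Qed.

(* The first time v n / B^n exceeds its initial values is a record. *)
Lemma record_growth (b B C : R) (v : nat -> R) (N : nat) :
  1 < B -> B < b -> 0 < C -> infinite_set [set n | C * b ^+ n <= v n] ->
  exists n, [/\ (N <= n)%N, B * v n <= v n.+1 & B ^+ n.+1 <= v n.+1].
Proof.
move=> B1 Bb C0 infv.
have B0 : 0 < B by rewrite (lt_trans _ B1).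
have Bn n : 0 < B ^+ n by rewrite exprn_gt0.
pose m := 1 + \sum_(k < N.+1) `|v k / B ^+ k|.
have m1 : 1 <= m by rewrite lerDl sumr_ge0.
have bB : 1 < b / B by rewrite ltr_pdivlMr // mul1r.
have [M HM] := linear_le_expn_eventually (m / C + 1) bB.
have [n vn Mn] := infinite_nat_ge (maxn M 1) infv.
have Pn : m < v n / B ^+ n.
  rewrite ltr_pdivlMr //; apply: (lt_le_trans _ vn).
  rewrite -ltr_pdivlMr // -mulrA -expr_div_n mulrC -ltr_pdivrMr //.
  apply: (lt_le_trans _ (HM n (leq_trans (leq_maxl _ _) Mn))).
  have n1 : 1 <= n%:R :> R by rewrite ler1n (leq_trans _ Mn) // leq_maxr.
  have : 0 <= m / C by rewrite divr_ge0 ?ltW // (lt_le_trans _ m1).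
  nra.
have [k Pk kmin] := ex_minnP (ex_intro (fun n => m < v n / B ^+ n) n Pn).
have Nk : (N < k)%N.
  rewrite ltnNge; apply/negP => kN; move: Pk; apply/negP; rewrite -leNgt.
  have kN' : (k < N.+1)%N by [].
  rewrite /m (bigD1 (Ordinal kN')) //= addrCA; apply: (le_trans (ler_norm _)).
  by rewrite lerDl addr_ge0 // sumr_ge0.
case: k Nk Pk kmin => // k Nk Pk kmin; exists k.
have vk : v k / B ^+ k <= m.
  by rewrite leNgt; apply/negP => /kmin; rewrite ltnn.
split => //.
  have := le_trans vk (ltW Pk); rewrite ler_pdivrMr // mulrAC ler_pdivlMr //.
  by rewrite exprS mulrCA mulrA ler_pM2r.
have := le_trans m1 (ltW Pk); by rewrite ler_pdivlMr // mul1r.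
Qed.

End Growth.

(** * Upper bound *)


Section UpperBound.
Context {R : realType}.
Implicit Types (z : R[i]) (w : seq (int * int)).

Definition hdigit z (n : nat) : int * int := digit (iter n gauss_map z)^-1.

Definition logsize w : R := \sum_(g <- w) ln (gsize g).

Definition hword z n : seq (int * int) := mkseq (hdigit z) n.

Lemma logsize_ge0 w : 0 <= logsize w.
Proof. by apply: sumr_ge0 => g _; rewrite ln_ge0 // gsize_ge1. Qed.

Lemma logsize_hwordS z n :
  logsize (hword z n.+1) = logsize (hword z n) + ln (gsize (hdigit z n)).
Proof. by rewrite /hword mkseqS /logsize -cats1 big_cat big_seq1. Qed.

Lemma expR_ln_gsize (g : int * int) : expR (ln (gsize g)) = gsize g :> R.
Proof. by rewrite lnK // posrE (lt_le_trans ltr01) // gsize_ge1. Qed.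

Lemma normc_le_expR z : fundamental_domain z -> z != 0 ->
  normc z <= 4 * expR (- 2^-1 * ln (gsize (digit z^-1))).
Proof.
move=> Fz z0.
rewrite -(@ler_pXn2r _ 2) ?nnegrE ?mulr_ge0 ?expR_ge0 ?normc_ge0 //.
rewrite exprMn -expRM_natl.
apply: (le_trans (normc_gsize_digit Fz z0)).
rewrite mulrA mulrN divff // mulN1r expRN expR_ln_gsize.
rewrite ler_pM2r ?invr_gt0 ?(lt_le_trans ltr01) ?gsize_ge1 //; lra.
Qed.

Lemma hword_contraction z z' n :
  fundamental_domain z -> fundamental_domain z' ->
  (forall i, (i < n)%N -> iter i gauss_map z != 0) ->
  (forall i, (i < n)%N -> iter i gauss_map z' != 0) ->
  hword z n = hword z' n ->
  normc (z - z') <= 16 ^+ n * expR (- logsize (hword z n)) *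
    normc (iter n gauss_map z - iter n gauss_map z').
Proof.
move=> Fz Fz'; elim: n => [|n IH] nz nz' ww'.
  by rewrite expr0 /hword /logsize big_nil oppr0 expR0 !mul1r.
have /rcons_inj E : rcons (hword z n) (hdigit z n) = rcons (hword z' n) (hdigit z' n).
  by rewrite -!mkseqS.
have wwn := congr1 fst E; have {E}dd := congr1 snd E.
rewrite /= in wwn dd.
have {}IH := IH (fun i h => nz i (ltnW h)) (fun i h => nz' i (ltnW h)) wwn.
apply: (le_trans IH); rewrite logsize_hwordS opprD expRD exprS !iterS.
have Ft := fundamental_domain_iter n Fz.
have Ft' := fundamental_domain_iter n Fz'.
have := nz n (ltnSn n); have := nz' n (ltnSn n); move: dd Ft Ft'.
rewrite /hdigit; set t := iter n _ z; set t' := iter n _ z' => dd Ft Ft' t'0 t0.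
set e := expR (- logsize _); have e0 : 0 <= e by exact: expR_ge0.
suff : normc (t - t') <= 16 * expR (- ln (gsize (digit t^-1))) *
    normc (gauss_map t - gauss_map t').
  move/(ler_wpM2l (mulr_ge0 (exprn_ge0 n (ler0n R 16)) e0)).
  move/le_trans; apply; rewrite le_eqVlt; apply/orP; left; apply/eqP.
  by rewrite -/e; ring.
have E : t^-1 - t'^-1 = gauss_map t - gauss_map t'.
  by rewrite (inv_gauss_map t0) (inv_gauss_map t'0) -dd opprD addrACA subrr add0r.
have := normc_inv_sub t0 t'0; rewrite E => ->.
have nt : 0 < normc t by rewrite normc_gt0.
have nt' : 0 < normc t' by rewrite normc_gt0.
have pt : 0 < normc t * normc t' by rewrite mulr_gt0.
rewrite mulrCA -[leLHS]mulr1; apply: ler_wpM2l; first exact: normc_ge0.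
rewrite ler_pdivlMr // mul1r expRN expR_ln_gsize.
have := normc_gsize_digit Ft t0; have := normc_gsize_digit Ft' t'0.
rewrite -dd; move: (16 / _) => c. have := sqr_ge0 (normc t - normc t'); nra.
Qed.

Definition record_cell (B L : R) w : set R[i] :=
  [set z | [/\ fundamental_domain z,
     forall i, (i <= size w)%N -> iter i gauss_map z != 0,
     hword z (size w) = w,
     B * logsize w <= logsize (hword z (size w).+1) &
     L * (size w).+1%:R <= logsize (hword z (size w).+1)]].

Lemma record_cell_tail (B L th : R) w z : 0 <= th <= 1 -> record_cell B L w z ->
  normc (iter (size w) gauss_map z) <=
    4 * expR (2^-1 * (logsize w - (1 - th) * B * logsize w
                      - th * L * (size w).+1%:R)).
Proof.
move=> /andP[th0 th1] [Fz nz wz h1 h2]; set n := size w in wz h1 h2 nz *.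
have Ft := fundamental_domain_iter n Fz.
apply: (le_trans (normc_le_expR Ft (nz n (leqnn n)))).
rewrite ler_pM2l // ler_expR -/(hdigit z n).
move: h1 h2; rewrite logsize_hwordS wz.
move: (ln _) (logsize w) (n.+1%:R) => l x m h1 h2; nra.
Qed.

Lemma record_cell_diam (B L th : R) w z z' : 0 <= th <= 1 ->
  record_cell B L w z -> record_cell B L w z' ->
  normc (z - z') <= 8 * 16 ^+ size w *
    expR (- 2^-1 * ((1 + (1 - th) * B) * logsize w + th * L * (size w).+1%:R)).
Proof.
move=> th01 Jz Jz'; have [Fz nz wz _ _] := Jz; have [Fz' nz' wz' _ _] := Jz'.
have := hword_contraction Fz Fz' (fun i h => nz i (ltnW h)) (fun i h => nz' i (ltnW h)).
rewrite wz wz' => /(_ erefl)/le_trans; apply.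
have := le_trans (normcB_le _ _)
  (lerD (record_cell_tail th01 Jz) (record_cell_tail th01 Jz')).
set a := expR _ => le8.
apply: (le_trans (ler_wpM2l _ le8)).
  by rewrite mulr_ge0 ?expR_ge0 // exprn_ge0.
have -> : 16 ^+ size w * expR (- logsize w) * (4 * a + 4 * a) =
    8 * 16 ^+ size w * (expR (- logsize w) * a) by ring.
rewrite ler_wpM2l ?mulr_ge0 ?exprn_ge0 // /a -expRD ler_expR.
by rewrite le_eqVlt; apply/orP; left; apply/eqP; field.
Qed.

Lemma Xi_io_record_cell (b c B L : R) z (N : nat) :
  1 < c -> 1 < B -> B < b -> Xi_io b c z ->
  exists n, (N <= n)%N /\ record_cell B L (hword z n) z.
Proof.
move=> c1 B1 Bb [Fz inf].
have c0 : 0 < c by rewrite (lt_trans _ c1).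
have nz i : iter i gauss_map z != 0.
  have [m [m0 [dm _]] im] := infinite_nat_ge i.+1 inf.
  move: dm; rewrite /hcf_defined; apply: contraNN => /eqP iz.
  have -> : m.-1 = ((m.-1 - i) + i)%N by rewrite subnK // -ltnS prednK.
  rewrite iterD iz; elim: (m.-1 - i)%N => //= k /eqP ->.
  by rewrite /gauss_map eqxx.
have lc : 0 < ln c by rewrite ln_gt0.
pose v n := logsize (hword z n).
have infv : infinite_set [set n | ln c * b ^+ n <= v n].
  apply: sub_infinite_set inf => n [/= n0 [_ hn]].
  case: n n0 hn => // n _ hn.
  rewrite /v logsize_hwordS; apply: (@le_trans _ _ (ln (gsize (hdigit z n)))); last first.
    by rewrite lerDr logsize_ge0.
  have gs0 := lt_le_trans ltr01 (gsize_ge1 (hdigit z n)) : 0 < gsize (hdigit z n) :> R.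
  rewrite mulrC -ln_powR ler_ln ?posrE ?powR_gt0 //.
  by apply: (le_trans hn); rewrite /hcf_quotient /hcf_first nearest_gaussE normc_gaussc_le.
have [M HM] := linear_le_expn_eventually L B1.
have [n [Nn h1 h2]] := record_growth (maxn M N) B1 Bb lc infv.
exists n; split; first by rewrite (leq_trans _ Nn) // leq_maxr.
split => //; rewrite ?size_mkseq //.
apply: le_trans h2; apply: HM; rewrite (leq_trans _ (leqnSn n)) //.
by rewrite (leq_trans _ Nn) // leq_maxl.
Qed.

Lemma sum_pickle_inv_le (S : countType) (g : nat -> R) (h : S -> R) (e : R) :
  (forall k, g k <= oapp h 0 (pickle_inv k)) ->
  (forall W : seq S, uniq W -> \sum_(w <- W) h w <= e) ->
  forall n, \sum_(0 <= k < n) g k <= e.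
Proof.
move=> gh he n.
apply: (@le_trans _ _ (\sum_(w <- pmap (@pickle_inv S) (iota 0 n)) h w)).
  by rewrite big_pmap /index_iota subn0; apply: ler_sum => k _; exact: gh.
by apply: he; apply: (pmap_uniq (@pickle_invK S)); exact: iota_uniq.
Qed.

Definition cell_cover (B L : R) (N k : nat) : set R[i] :=
  if (pickle_inv k : option (seq (int * int))) is Some w then
    if (N <= size w)%N then record_cell B L w else set0
  else set0.

Lemma exists_expn_small (C e : R) : 0 <= C -> 0 < e -> exists N, C * 2^-1 ^+ N <= e.
Proof.
move=> C0 e0; pose N := (Num.truncn (C / e)).+1; exists N.
have h : C / e <= N%:R by apply/ltW; rewrite /N truncnS_gt.
have := @bernoulli R 1 N ler01; rewrite mulr1 (_ : 1 + 1 = 2) // => h2.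
rewrite exprVn ler_pdivrMr ?exprn_gt0 //.
have h3 : C <= N%:R * e by rewrite -ler_pdivrMr.
apply: (le_trans h3); rewrite mulrC ler_pM2l //; lra.
Qed.

Lemma hausdorff_measure_Xi_io (b c s : R) : 1 < b -> 1 < c -> 0 < s ->
  2 / (1 + b) < s -> hausdorff_measure s (Xi_io b c) = 0%E.
Proof.
move=> b1 c1 s0 sb; apply: hausdorff_measure_eq0 => // e e0.
pose m := Num.max 1 (2 / s - 1).
have mb : m < b.
  rewrite gt_max b1 /= ltrBlDr ltr_pdivrMr // mulrC.
  by move: sb; rewrite ltr_pdivrMr 1?addrC // addr_gt0 // (lt_trans _ b1).
have m1 : 1 <= m by rewrite le_max lexx.
have ms : 2 <= s * (1 + m).
  have : 2 / s - 1 <= m by rewrite le_max lexx orbT.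
  by rewrite lerBlDr ler_pdivrMr // mulrC addrC.
pose B := (m + b) / 2; pose kap := (m + B) / 2.
have mB : m < B by rewrite /B; lra.
have Bb : B < b by rewrite /B; lra.
have mk : m < kap by rewrite /kap; lra.
have kB : kap < B by rewrite /kap; lra.
have B0 : 0 < B by lra.
pose th := 1 - kap / B.
have th0 : 0 < th by rewrite subr_gt0 ltr_pdivrMr // mul1r.
have th1 : th <= 1 by rewrite gerBl divr_ge0 //; lra.
have thB : (1 - th) * B = kap by rewrite /th opprB addrC subrK divfK // gt_eqF.
pose p := s / 2 * (1 + kap).
have p1 : 1 < p by rewrite /p; nra.
pose M := (2 * (1 + (p - 1)^-1)) ^+ 2.
have M0 : 0 < M.
  by rewrite exprn_gt0 // mulr_gt0 // addr_gt0 // invr_gt0 subr_gt0.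
have M2 : 0 < 2 * M by rewrite mulr_gt0.
pose lr := - ln (2 * M).
pose L := Num.max 0 (2 / (th * s) * (s * ln 16 - lr)).
have L0 : 0 <= L by rewrite le_max lexx.
have Llr : s * ln 16 - lr <= 2^-1 * (th * s) * L.
  have : 2 / (th * s) * (s * ln 16 - lr) <= L by rewrite le_max lexx orbT.
  by rewrite -mulrA mulrCA ler_pdivrMl ?mulr_gt0 // => h; lra.
pose f (g : int * int) := expR (lr - p * ln (gsize g)).
have fE (g : int * int) : f g = (2 * M)^-1 * gsize g `^ (- p).
  have g0 := lt_le_trans ltr01 (gsize_ge1 g) : 0 < gsize g :> R.
  rewrite /f expRD /lr expRN lnK //; congr (_ * _).
  by rewrite /powR (gt_eqF g0) mulNr.
have f1 S : uniq S -> \sum_(g <- S) f g <= 2^-1.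
  move=> uS; under eq_bigr do rewrite fE; rewrite -mulr_sumr.
  rewrite ler_pdivrMl // mulrAC divff // mul1r.
  exact: sum_gsize_powR_le.
have prodf w : \prod_(g <- w) f g = expR ((size w)%:R * lr - p * logsize w).
  rewrite /logsize; elim: w => [|g w IH]; first by rewrite !big_nil mul0r mulr0 subr0 expR0.
  rewrite !big_cons IH /f -expRD /= -[(size w).+1]addn1 natrD; congr expR; ring.
pose C := expR (s * ln 8).
have gaugeJ w : (gauge s (record_cell B L w) <= (C * \prod_(g <- w) f g)%:E)%E.
  apply: (@gauge_le _ _ _ (8 * 16 ^+ size w *
    expR (- 2^-1 * ((1 + (1 - th) * B) * logsize w + th * L * (size w).+1%:R)))).
  - exact: ltW.
  - by rewrite mulr_ge0 ?expR_ge0 // mulr_ge0 // exprn_ge0.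
  - by rewrite mulr_ge0 ?expR_ge0 // prodf expR_ge0.
  - by move=> x y Jx Jy; apply: record_cell_diam => //; rewrite ltW.
  rewrite prodf /C -expRD thB.
  have -> : 8 * 16 ^+ size w = expR (ln 8 + (size w)%:R * ln 16) :> R.
    by rewrite expRD expRM_natl !lnK ?posrE.
  rewrite -expRD /powR gt_eqF ?expR_gt0 // expRK ler_expR.
  have n0 : 0 <= (size w)%:R :> R by [].
  rewrite -[(size w).+1]addn1 natrD /p.
  have := ler_wpM2l n0 Llr.
  have : 0 <= th * s * L by rewrite !mulr_ge0 // ltW.
  move: (_%:R) (logsize w) (ln 8) (ln 16) => x l a1 a2; lra.
have C0 : 0 <= C * 2 by rewrite mulr_ge0 // expR_ge0.
have [N CN] := exists_expn_small C0 e0.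
exists (cell_cover B L N); split.
  move=> z /(Xi_io_record_cell L N c1 (le_lt_trans m1 mB) Bb)[n [Nn Jz]].
  exists (pickle (hword z n)) => //.
  by rewrite /cell_cover pickleK_inv size_mkseq Nn.
have gU k : (gauge s (cell_cover B L N k) <=
    (oapp (fun w => if (N <= size w)%N then C * \prod_(g <- w) f g else 0) 0
      (pickle_inv k))%:E)%E.
  rewrite /cell_cover; case: (pickle_inv k) => [w|] /=; last by rewrite /gauge eqxx.
  by case: ifP => // _; rewrite /gauge eqxx.
apply: (le_trans (lee_nneseries _ (fun k _ => gU k))) => [k _ _|].
  exact: gauge_ge0.
apply: lime_le.
  apply: is_cvg_nneseries => k _ _; apply: le_trans (gU k); exact: gauge_ge0.
apply: nearW => n; rewrite sumEFin lee_fin.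
apply: (@sum_pickle_inv_le _ _
  (fun w => if (N <= size w)%N then C * \prod_(g <- w) f g else 0)) => // W uW.
rewrite -big_mkcond -big_filter -mulr_sumr; apply: le_trans CN; rewrite -mulrA.
rewrite ler_wpM2l ?expR_ge0 //; apply: sum_words_geometric => //.
- by move=> g; exact: expR_ge0.
- exact: filter_uniq.
- by move=> w; rewrite mem_filter => /andP[].
Qed.

End UpperBound.

(** * Continued fractions with digits in boxes *)


Section Limits.
Context {R : realType}.

Lemma le_expn_small (C y z : R) : 0 <= C ->
  (forall k, y <= z + C * 2^-1 ^+ k) -> y <= z.
Proof.
move=> C0 h; apply/ler_addgt0Pr => e e0.
have [N hN] := exists_expn_small C0 e0.
by apply: (le_trans (h N)); rewrite lerD2l.
Qed.

Lemma effective_limit (u e : nat -> R) :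
  (forall k j, `|u (k + j)%N - u k| <= e k) ->
  exists l, forall k, `|u k - l| <= e k.
Proof.
move=> ue; pose E := [set u k - e k | k in setT].
have cross k m : u k - e k <= u m + e m.
  have := ue k (maxn k m - k)%N; have := ue m (maxn k m - m)%N.
  rewrite !subnKC ?leq_maxl ?leq_maxr // !ler_norml => /andP[? ?] /andP[? ?]; lra.
have ubE m : ubound E (u m + e m) by move=> _ [k _ <-]; exact: cross.
exists (sup E) => k; rewrite ler_distlC; apply/andP; split.
  by apply: ub_le_sup; [exists (u 0%N + e 0%N)|exists k].
by apply: ge_sup; [exists (u 0%N - e 0%N); exists 0%N|exact: ubE].
Qed.

Lemma effective_limitc (u : nat -> R[i]) (e : nat -> R) :
  (forall k j, normc (u (k + j)%N - u k) <= e k) ->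
  exists l, forall k, normc (u k - l) <= 2 * e k.
Proof.
move=> ue.
have ReB (x y : R[i]) : complex.Re (x - y) = complex.Re x - complex.Re y by case: x; case: y.
have ImB (x y : R[i]) : complex.Im (x - y) = complex.Im x - complex.Im y by case: x; case: y.
have [|l1 h1] := @effective_limit (fun k => complex.Re (u k)) e.
  by move=> k j; rewrite -ReB (le_trans (normRe_le_normc _)).
have [|l2 h2] := @effective_limit (fun k => complex.Im (u k)) e.
  by move=> k j; rewrite -ImB (le_trans (normIm_le_normc _)).
exists (l1 +i* l2) => k; apply: (le_trans (normc_le_ReIm _)).
by rewrite ReB ImB mulr_natl mulr2n lerD.
Qed.

End Limits.

Section DigitBoxes.
Context {R : realType}.
Implicit Types (m : nat) (d : nat * nat) (w z : R[i]).

Definition boxc m d : R[i] := gaussc (Posz (m + d.1), Posz d.2).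

Definition box m : seq (nat * nat) := [seq (i, j) | i <- iota 0 m, j <- iota 0 m].

Lemma mem_box m d : (d \in box m) = (d.1 < m)%N && (d.2 < m)%N.
Proof.
apply/allpairsP/andP => [[[i j] /= [im jm ->]]|[d1 d2]].
  by move: im jm; rewrite !mem_iota !add0n.
by exists d; rewrite !mem_iota !add0n d1 d2; split=> //; case: d {d1 d2}.
Qed.

Lemma uniq_box m : uniq (box m).
Proof. by apply: allpairs_uniq; rewrite ?iota_uniq // => -[? ?] [? ?]. Qed.

Lemma size_box m : size (box m) = (m ^ 2)%N.
Proof. by rewrite size_allpairs size_iota mulnn. Qed.

Lemma normc_boxc m d : d \in box m -> m%:R <= normc (boxc m d) <= 3 * m%:R.
Proof.
rewrite mem_box => /andP[d1 d2]; apply/andP; split.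
  apply: (le_trans _ (normRe_le_normc _)); apply: (le_trans _ (ler_norm _)).
  by rewrite /= -pmulrn ler_nat leq_addr.
apply: (le_trans (normc_le_ReIm _)); rewrite /= -!pmulrn !normr_nat.
by rewrite -natrM -natrD ler_nat; lia.
Qed.

Lemma normc_boxcD m d w : (4 <= m)%N -> d \in box m -> normc w <= 3^-1 ->
  3 <= normc (boxc m d + w) <= 4 * m%:R.
Proof.
move=> m4 /normc_boxc/andP[h1 h2] w3.
have m4' : 4 <= m%:R :> R by rewrite ler_nat.
have := normcD_le (boxc m d) w; have := normcD_ge (boxc m d) w.
by move=> h3 h4; apply/andP; split; lra.
Qed.

Lemma boxcD_neq0 m d w : (4 <= m)%N -> d \in box m -> normc w <= 3^-1 ->
  boxc m d + w != 0.
Proof.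
move=> m4 dm w3; have /andP[h _] := normc_boxcD m4 dm w3.
by rewrite -normc_gt0 (lt_le_trans _ h).
Qed.

Lemma boxc_dist m d d' :
  `|d.1%:R - d'.1%:R| <= normc (boxc m d - boxc m d') /\
  `|d.2%:R - d'.2%:R| <= normc (boxc m d - boxc m d').
Proof.
split.
  apply: (le_trans _ (normRe_le_normc _)); rewrite /= -!pmulrn !natrD.
  by rewrite opprD addrACA subrr add0r.
by apply: (le_trans _ (normIm_le_normc _)); rewrite /= -!pmulrn.
Qed.

Lemma boxc_dist_ge1 m d d' : d != d' -> 1 <= normc (boxc m d - boxc m d').
Proof.
have h (i j : nat) : i != j -> 1 <= `|i%:R - j%:R| :> R.
  move=> ij; have -> : i%:R - j%:R = (Posz i - Posz j)%:~R :> R.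
    by rewrite intrB -!pmulrn.
  by rewrite -intr_norm ler1z -gtz0_ge1 normr_gt0 subr_eq0 eqz_nat.
have [h1 h2] := boxc_dist m d d'.
case: d d' h1 h2 => [i j] [i' j'] /= h1 h2; rewrite xpair_eqE negb_and.
by case/orP=> /h; [move/le_trans; apply|move/le_trans; apply].
Qed.

Lemma inv_boxc_expanding m d d' w w' : (4 <= m)%N -> d \in box m -> d' \in box m ->
  normc w <= 3^-1 -> normc w' <= 3^-1 ->
  (16 * m%:R ^+ 2)^-1 * normc ((boxc m d + w) - (boxc m d' + w')) <=
  normc ((boxc m d + w)^-1 - (boxc m d' + w')^-1).
Proof.
move=> m4 dm dm' w3 w3'.
have /andP[h1 h2] := normc_boxcD m4 dm w3.
have /andP[h1' h2'] := normc_boxcD m4 dm' w3'.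
rewrite normc_inv_sub ?boxcD_neq0 // mulrC ler_wpM2l ?normc_ge0 //.
rewrite lef_pV2 ?posrE ?mulr_gt0 ?exprn_gt0 ?ltr0n ?(leq_trans _ m4) //;
  try by apply: lt_le_trans h1.
  have -> : 16 * m%:R ^+ 2 = (4 * m%:R) * (4 * m%:R) :> R by ring.
  by apply: ler_pM; rewrite ?normc_ge0.
by apply: lt_le_trans h1'.
Qed.

Lemma inv_boxc_contracting m d w w' : (4 <= m)%N -> d \in box m ->
  normc w <= 3^-1 -> normc w' <= 3^-1 ->
  normc ((boxc m d + w)^-1 - (boxc m d + w')^-1) <= 2^-1 * normc (w - w').
Proof.
move=> m4 dm w3 w3'.
have /andP[h1 _] := normc_boxcD m4 dm w3.
have /andP[h1' _] := normc_boxcD m4 dm w3'.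
rewrite normc_inv_sub ?boxcD_neq0 // opprD addrACA subrr add0r mulrC.
rewrite ler_wpM2r ?normc_ge0 // lef_pV2 ?posrE ?mulr_gt0 //; nra.
Qed.

Lemma normc_inv_boxc m d w : (4 <= m)%N -> d \in box m -> normc w <= 3^-1 ->
  normc (boxc m d + w)^-1 <= 3^-1.
Proof.
move=> m4 dm w3; have /andP[h1 _] := normc_boxcD m4 dm w3.
by rewrite normcV lef_pV2 ?posrE // (lt_le_trans _ h1).
Qed.

End DigitBoxes.

Section BoxFractions.
Context {R : realType} (r : nat -> nat).
Hypothesis r4 : forall n, (4 <= r n)%N.
Implicit Types (d : nat -> nat * nat) (x : nat -> R[i]).

(* [x n] is the n-th tail: the point itself is [x 0], with digits [d]. *)
Definition box_fraction d x := forall n,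
  [/\ d n \in box (r n), normc (x n) <= 3^-1 &
      x n = (boxc (r n) (d n) + x n.+1)^-1].

Definition box_scale (n : nat) : R := \prod_(i < n) (16 * (r i)%:R ^+ 2)^-1.

Lemma box_scale_gt0 n : 0 < box_scale n.
Proof.
apply: prodr_gt0 => i _; rewrite invr_gt0 mulr_gt0 // exprn_gt0 // ltr0n.
exact: leq_trans (r4 i).
Qed.

Lemma box_scaleS n : box_scale n.+1 = box_scale n * (16 * (r n)%:R ^+ 2)^-1.
Proof. by rewrite /box_scale big_ord_recr. Qed.

Lemma box_scale_half n : box_scale n.+1 <= 2^-1 * box_scale n.
Proof.
rewrite box_scaleS mulrC ler_wpM2r ?(ltW (box_scale_gt0 n)) //.
have : 4 <= (r n)%:R :> R by rewrite ler_nat.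
move: (r n)%:R => m m4.
by rewrite lef_pV2 ?posrE ?mulr_gt0 ?exprn_gt0 //; nra.
Qed.

Lemma box_scale_le m n : (m <= n)%N -> box_scale n <= box_scale m.
Proof.
elim: n => [|n IH]; first by rewrite leqn0 => /eqP ->.
rewrite leq_eqVlt => /predU1P[->//|/IH h]; apply: le_trans h.
have := box_scale_half n; have := box_scale_gt0 n; lra.
Qed.

Lemma box_scale_exp n : box_scale n <= 2^-1 ^+ n.
Proof.
elim: n => [|n IH]; first by rewrite /box_scale big_ord0 expr0.
by rewrite exprS (le_trans (box_scale_half n)) // ler_pM2l.
Qed.

Lemma box_fraction_prefix_dist d x d' x' n :
  box_fraction d x -> box_fraction d' x' -> (forall i, (i < n)%N -> d i = d' i) ->
  box_scale n * normc (x n - x' n) <= normc (x 0%N - x' 0%N).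
Proof.
move=> fx fx'; elim: n => [|n IH] dd'; first by rewrite /box_scale big_ord0 mul1r.
apply: le_trans (IH (fun i h => dd' i (ltnW h))).
have [dn _ ->] := fx n; have [dn' _ ->] := fx' n.
have [_ x3 _] := fx n.+1; have [_ x3' _] := fx' n.+1.
rewrite box_scaleS -mulrA ler_pM2l ?box_scale_gt0 //.
apply: le_trans (inv_boxc_expanding (r4 n) dn dn' x3 x3').
by rewrite (dd' n (ltnSn n)) opprD addrACA subrr add0r.
Qed.

Lemma box_fraction_dist d x d' x' n :
  box_fraction d x -> box_fraction d' x' -> (forall i, (i < n)%N -> d i = d' i) ->
  box_scale n.+1 / 3 * normc (boxc (r n) (d n) - boxc (r n) (d' n)) <=
  normc (x 0%N - x' 0%N).
Proof.
move=> fx fx' dd'.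
have [->|neq] := eqVneq (d n) (d' n); first by rewrite subrr normc0 mulr0 normc_ge0.
apply: le_trans (box_fraction_prefix_dist fx fx' dd').
have [dn _ ->] := fx n; have [dn' _ ->] := fx' n.
have [_ x3 _] := fx n.+1; have [_ x3' _] := fx' n.+1.
rewrite box_scaleS -!mulrA ler_pM2l ?box_scale_gt0 //.
apply: le_trans (inv_boxc_expanding (r4 n) dn dn' x3 x3').
rewrite ler_wpM2l ?invr_ge0 ?mulr_ge0 ?exprn_ge0 //.
have := @boxc_dist_ge1 R (r n) _ _ neq.
have := normcD_ge (boxc (r n) (d n) - boxc (r n) (d' n)) (x n.+1 - x' n.+1).
have := normcB_le (x n.+1) (x' n.+1).
rewrite (addrACA (boxc _ _)) -opprD; lra.
Qed.

Fixpoint box_convergent d (k n : nat) : R[i] :=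
  if k is j.+1 then (boxc (r n) (d n) + box_convergent d j n.+1)^-1 else 0.

Lemma box_fraction_exists d : (forall n, d n \in box (r n)) ->
  exists x, box_fraction d x.
Proof.
move=> dr.
have c3 k n : normc (box_convergent d k n) <= 3^-1.
  elim: k n => [|k IH] n; first by rewrite normc0 invr_ge0.
  exact: normc_inv_boxc.
have cauchy n k j :
    normc (box_convergent d (k + j) n - box_convergent d k n) <= 2^-1 ^+ k.
  elim: k n => [|k IH] n /=.
    by rewrite subr0 expr0 (le_trans (c3 _ _)) // invf_le1 // ler1n.
  rewrite exprS; apply: (le_trans (inv_boxc_contracting _ _ _ _)) => //.
  by rewrite ler_pM2l.
have /choice[x hx] : forall n, exists l, forall k,
    normc (box_convergent d k n - l) <= 2 * 2^-1 ^+ k.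
  by move=> n; exact: effective_limitc (cauchy n).
have x3 n : normc (x n) <= 3^-1.
  apply: (@le_expn_small _ 2) => // k.
  have := normcB_le (box_convergent d k n) (box_convergent d k n - x n).
  have := c3 k n; have := hx n k; rewrite subKr; lra.
exists x => n; split => //.
apply/eqP; rewrite -subr_eq0; apply/eqP/eq0_normc/eqP.
rewrite eq_le normc_ge0 andbT; apply: (@le_expn_small _ 4) => // k.
have h1 := hx n k.+1; have h2 := hx n.+1 k.
have h3 := inv_boxc_contracting (r4 n) (dr n) (c3 k n.+1) (x3 n.+1).
have := normcB_le (box_convergent d k.+1 n - (boxc (r n) (d n) + x n.+1)^-1)
  (box_convergent d k.+1 n - x n).
rewrite opprB addrC addrA subrK add0r; move: h1; rewrite exprS /=.
have : 0 <= 2^-1 ^+ k :> R by rewrite exprn_ge0.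
lra.
Qed.

Lemma iter_gauss_map_box_fraction d x n : box_fraction d x ->
  iter n gauss_map (x 0%N) = x n.
Proof.
move=> fx; elim: n => //= n ->.
have [dn _ ->] := fx n; have [_ x3 _] := fx n.+1.
rewrite gauss_map_inv ?boxcD_neq0 //; apply: fundamental_domain_small; lra.
Qed.

Lemma box_fraction_Xi_all (b c : R) d x :
  (forall n, c `^ (b ^+ n.+1) <= (r n)%:R) -> box_fraction d x -> Xi_all b c (x 0%N).
Proof.
move=> rc fx; split.
  by apply: fundamental_domain_small; have [_ + _] := fx 0%N; lra.
case=> // n _; rewrite /large_quotient /hcf_defined /hcf_quotient -[n.+1.-1]/n.
rewrite (iter_gauss_map_box_fraction n fx).
have [dn _ xE] := fx n; have [_ x3 _] := fx n.+1.
rewrite xE invr_eq0 boxcD_neq0 //; split => //.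
rewrite /hcf_first invrK nearest_gaussE digit_gaussD.
  by apply: (le_trans (rc n)); have /andP[] := @normc_boxc R _ _ dn.
by apply: fundamental_domain_small; lra.
Qed.

End BoxFractions.

(** * The tree of digits *)


Lemma ler_sum_single (R : realType) (T : eqType) (s : seq T) (g : T -> R) (Y : R) :
  uniq s -> 0 <= Y -> (forall a, a \in s -> g a <= Y) ->
  (forall a a', g a != 0 -> g a' != 0 -> a = a') ->
  \sum_(a <- s) g a <= Y.
Proof.
move=> us Y0 gY g1.
have [/hasP[a sa ga]|/hasPn h] := boolP (has (fun a => g a != 0) s).
  rewrite (bigD1_seq a) //= big1 ?addr0 ?gY // => a' aa'.
  by apply/eqP; apply: contraNT aa' => ga'; rewrite (g1 _ _ ga ga').
rewrite big_seq big1 // => a /h; by rewrite negbK => /eqP.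
Qed.

Section BoxTree.
Context {R : realType} (r : nat -> nat).
Hypothesis r4 : forall n, (4 <= r n)%N.
Implicit Types (U : set R[i]) (w : seq (nat * nat)) (d : nat -> nat * nat).

Definition hits U w : bool :=
  `[< exists d x, [/\ box_fraction r d x, U (x 0%N) &
        forall i, (i < size w)%N -> d i = nth (0, 0)%N w i] >].

(* The proportion, among the extensions of [w] by [j] admissible digits, of
   those whose cylinder meets [U]. *)
Fixpoint hit_mass U (j : nat) w : R :=
  if j is j'.+1 then
    ((r (size w))%:R ^+ 2)^-1 * \sum_(a <- box (r (size w))) hit_mass U j' (rcons w a)
  else (hits U w)%:R.

Lemma r_gt0 n : 0 < (r n)%:R :> R.
Proof. by rewrite ltr0n (leq_trans _ (r4 n)). Qed.

Lemma rV_ge0 n : 0 <= ((r n)%:R ^+ 2)^-1 :> R.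
Proof. by rewrite invr_ge0 exprn_ge0. Qed.

Lemma sum_box_const n (c : R) : \sum_(a <- box (r n)) c = (r n)%:R ^+ 2 * c.
Proof.
by rewrite big_const_seq count_predT size_box iter_addr_0 -natrX mulr_natl.
Qed.

Lemma hit_mass_ge0 U j w : 0 <= hit_mass U j w.
Proof.
elim: j w => [|j IH] w /=; first exact: ler0n.
by rewrite mulr_ge0 ?rV_ge0 // sumr_ge0.
Qed.

Lemma hits_rcons U w a : hits U (rcons w a) -> hits U w.
Proof.
move=> /asboolP[d [x [fx Ux dw]]]; apply/asboolP; exists d, x; split => // i iw.
by rewrite dw ?size_rcons ?ltnS ?(ltnW iw) // nth_rcons iw.
Qed.

Lemma hits_rconsP U w a : hits U (rcons w a) -> exists d x,
  [/\ box_fraction r d x, U (x 0%N),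
   forall i, (i < size w)%N -> d i = nth (0, 0)%N w i & d (size w) = a].
Proof.
move=> /asboolP[d [x [fx Ux dw]]]; exists d, x; split => // [i iw|].
  by rewrite dw ?size_rcons ?ltnS ?(ltnW iw) // nth_rcons iw.
by rewrite dw ?size_rcons // nth_rcons ltnn eqxx.
Qed.

Lemma hit_mass_eq0 U j w : ~~ hits U w -> hit_mass U j w = 0.
Proof.
elim: j w => [|j IH] w hw /=; first by rewrite (negbTE hw).
by rewrite big1 ?mulr0 // => a _; apply: IH; apply: contra hw; exact: hits_rcons.
Qed.

Lemma hit_mass_le1 U j w : hit_mass U j w <= 1.
Proof.
elim: j w => [|j IH] w /=; first by case: hits.
rewrite ler_pdivrMl ?exprn_gt0 ?r_gt0 // -sum_box_const; exact: ler_sum.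
Qed.

Lemma hit_mass_average U n w :
  \sum_(a <- box (r (size w))) hit_mass U (n - size (rcons w a)) (rcons w a)
    <= (r (size w))%:R ^+ 2 * hit_mass U (n - size w) w.
Proof.
have r2 : 0 < (r (size w))%:R ^+ 2 :> R by rewrite exprn_gt0 ?r_gt0.
under eq_bigr do rewrite size_rcons.
have [wn|nw] := ltnP (size w) n.
  rewrite -(subnSK wn) /= mulrA divff ?mul1r //; by rewrite gt_eqF.
have -> : (n - size w = 0)%N by apply/eqP.
have -> : (n - (size w).+1 = 0)%N by apply/eqP; rewrite subn_eq0 ltnW.
rewrite -sum_box_const; apply: ler_sum => a _ /=.
by case: (boolP (hits U (rcons w a))) => [/hits_rcons ->|].
Qed.

Section OneSet.
Variables (U : set R[i]) (D : R) (n : nat).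
Hypothesis UD : forall z z', U z -> U z' -> normc (z - z') <= D.
Hypothesis D_lt : D < box_scale r n / 3.
Hypothesis D_ge : box_scale r n.+1 / 3 <= D.

Lemma hits_unique w a a' : (size w < n)%N ->
  hits U (rcons w a) -> hits U (rcons w a') -> a = a'.
Proof.
move=> wn /hits_rconsP[d [x [fx Ux dw da]]] /hits_rconsP[d' [x' [fx' Ux' dw' da']]].
apply/eqP/negPn/negP => aa'.
have dd' i : (i < size w)%N -> d i = d' i by move=> iw; rewrite dw ?dw'.
have := box_fraction_dist r4 fx fx' dd'; rewrite da da'.
have := @boxc_dist_ge1 R (r (size w)) _ _ aa'.
have := @box_scale_le R r r4 _ _ wn; have := @box_scale_gt0 R r r4 (size w).+1.
have := UD Ux Ux'; move: D_lt.
move: (box_scale r n) (box_scale r (size w).+1) (normc _) (normc _) => q q' u v.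
by move=> {aa' da da'} h1 h2 h3 h4 h5 h6; nra.
Qed.

Lemma hits_count w : size w = n ->
  \sum_(a <- box (r n)) (hits U (rcons w a))%:R <= (3 * (3 * D / box_scale r n.+1)) ^+ 2.
Proof.
move=> wn; set t := 3 * D / _.
have q0 := @box_scale_gt0 R r r4 n.+1.
have t1 : 1 <= t by rewrite ler_pdivlMr // mul1r; move: D_ge; lra.
pose T := Num.truncn t.
have Tt : T%:R <= t by rewrite truncn_le // (le_trans ler01).
have [/hasP[a0 _ /hits_rconsP[d [x [fx Ux dw da]]]]|/hasPn h] :=
    boolP (has (fun a => hits U (rcons w a)) (box (r n))); last first.
  by rewrite big_seq big1 ?sqr_ge0 // => a /h/negbTE ->.
pose near i := iota (i - T) (2 * T).+1.
have nearP (i j : nat) : `|i%:R - j%:R| <= t -> j \in near i.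
  move=> ij; have {}ij : (`|Posz i - Posz j| <= T)%N.
    rewrite /T truncn_ge_nat ?(le_trans ler01) //.
    by rewrite natr_absz intr_norm intrB -!pmulrn.
  by rewrite mem_iota; lia.
have -> : \sum_(a <- box (r n)) (hits U (rcons w a))%:R =
    \sum_(a <- [seq a <- box (r n) | hits U (rcons w a)]) 1 :> R.
  by rewrite big_filter [RHS]big_mkcond; apply: eq_bigr => a _; case: hits.
apply: (@le_trans _ _ (\sum_(a <- [seq (i, j) | i <- near a0.1, j <- near a0.2]) 1)).
  apply: ler_sum_uniq_sub => //.
  - by rewrite filter_uniq // uniq_box.
  - by apply: allpairs_uniq; rewrite ?iota_uniq // => -[? ?] [? ?].
  move=> a; rewrite mem_filter => /andP[/hits_rconsP[d' [x' [fx' Ux' dw' da']]] _].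
  have dd' i : (i < n)%N -> d i = d' i by move=> iw; rewrite dw ?dw' ?wn.
  have := box_fraction_dist r4 fx fx' dd'; rewrite -wn da da' wn => h.
  have h' : normc (boxc (r n) a0 - boxc (r n) a) <= t.
    rewrite ler_pdivlMr // mulrC; have := UD Ux Ux'; lra.
  have [h1 h2] := @boxc_dist R (r n) a0 a.
  apply/allpairsP; exists a; split.
  - by apply: nearP; exact: le_trans h1 h'.
  - by apply: nearP; exact: le_trans h2 h'.
  - by case: a {h h' h1 h2 da'}.
rewrite big_const_seq count_predT size_allpairs !size_iota iter_addr_0 mulnn.
have tT : (2 * T).+1%:R <= 3 * t by rewrite -[(2 * T).+1]addn1 natrD natrM; lra.
by rewrite natrX lerXn2r ?nnegrE // (le_trans _ tT).
Qed.

Lemma hit_mass_le_of_size w (Y : R) j :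
  (forall w', size w' = n -> hit_mass U 1 w' <= Y) -> 0 <= Y ->
  (size w + j)%N = n ->
  hit_mass U j.+1 w <= Y * \prod_(size w <= l < n) ((r l)%:R ^+ 2)^-1.
Proof.
move=> hY Y0; elim: j w => [|j IH] w wn.
  by rewrite addn0 in wn; rewrite wn big_geq // mulr1 hY.
have wn' : (size w < n)%N by rewrite -wn -addSnnS leq_addr.
rewrite big_ltn // mulrCA; rewrite [hit_mass _ _ _]/=.
rewrite ler_wpM2l ?rV_ge0 //.
apply: (@ler_sum_single _ _ _ (fun a => hit_mass U j.+1 (rcons w a))).
- exact: uniq_box.
- by rewrite mulr_ge0 // prodr_ge0 // => l _; exact: rV_ge0.
- by move=> a _; rewrite -(size_rcons w a) IH // size_rcons -wn addSnnS.
move=> a a' ha ha'.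
have hh e : hit_mass U j.+1 (rcons w e) != 0 -> hits U (rcons w e).
  by apply: contraNT => /(hit_mass_eq0 j.+1) ->.
by apply: (hits_unique wn'); exact: hh.
Qed.

Lemma hit_mass_root_le (s : R) : 0 < s <= 2 ->
  hit_mass U n.+1 [::] <= D `^ s *
    ((9 / (box_scale r n.+1 * (r n)%:R)) `^ s * \prod_(l < n) ((r l)%:R ^+ 2)^-1).
Proof.
move=> /andP[s0 s2].
have q0 := @box_scale_gt0 R r r4 n.+1.
have D0 : 0 < D by apply: lt_le_trans D_ge; rewrite divr_gt0.
pose y := 9 * D / (box_scale r n.+1 * (r n)%:R).
have y0 : 0 < y by rewrite divr_gt0 ?mulr_gt0 ?r_gt0.
have -> : D `^ s * ((9 / (box_scale r n.+1 * (r n)%:R)) `^ s *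
    \prod_(l < n) ((r l)%:R ^+ 2)^-1) = y `^ s * \prod_(0 <= l < n) ((r l)%:R ^+ 2)^-1.
  rewrite mulrA -powRM ?divr_ge0 ?mulr_ge0 ?(ltW D0) ?(ltW q0) //.
  by rewrite big_mkord /y mulrCA mulrA.
apply: (@hit_mass_le_of_size [::]); rewrite ?powR_ge0 //= => w wn.
have [y1|y1] := leP 1 y.
  apply: (le_trans (hit_mass_le1 _ 1 _)).
  have := @ge0_ler_powR R s (ltW s0) 1 y; rewrite powR1.
  by apply; rewrite ?nnegrE ?(ltW y0).
apply: (@le_trans _ _ (y ^+ 2)).
  rewrite wn ler_pdivrMl ?exprn_gt0 ?r_gt0 //.
  apply: (le_trans (hits_count wn)); rewrite -exprMn le_eqVlt; apply/orP; left.
  by apply/eqP; congr (_ ^+ 2); rewrite /y; field; rewrite !gt_eqF ?r_gt0.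
by rewrite -powR_mulrn ?(ltW y0) //; apply: ger_powR => //; rewrite y0 ltW.
Qed.

End OneSet.

Lemma exists_hit_mass_le U (D s K : R) : 0 < s <= 2 -> 0 < D -> D < 3^-1 ->
  (forall z z', U z -> U z' -> normc (z - z') <= D) ->
  (forall n, (9 / (box_scale r n.+1 * (r n)%:R)) `^ s *
             \prod_(l < n) ((r l)%:R ^+ 2)^-1 <= K) ->
  exists n, hit_mass U n [::] <= K * D `^ s.
Proof.
move=> s02 D0 D3 UD HK.
have ex : exists n, box_scale r n.+1 / 3 <= D.
  have [N hN] := @exists_expn_small R 1 (3 * D) ler01 (mulr_gt0 (ltr0n _ 3) D0).
  exists N; rewrite ler_pdivrMr // mulrC; apply: le_trans hN; rewrite mul1r.
  by apply: le_trans (@box_scale_exp R r r4 N); apply: box_scale_le.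
have [n Dn nmin] := ex_minnP ex.
exists n.+1; rewrite mulrC.
apply: (le_trans (@hit_mass_root_le U D n UD _ Dn s s02)); last first.
  by rewrite ler_wpM2l ?powR_ge0.
case: n Dn nmin => [|n] _ nmin; first by rewrite /box_scale big_ord0 mul1r.
by rewrite ltNge; apply/negP => /nmin; rewrite ltnn.
Qed.

(* Following a child with total hit mass below 1 at each level produces a
   point avoiding every set of the family. *)
Lemma exists_box_fraction_avoiding (U : nat -> set R[i]) (N : nat -> nat) :
  (\sum_(0 <= k <oo) (hit_mass (U k) (N k) [::])%:E < 1%:E)%E ->
  exists d x, box_fraction r d x /\ forall k, ~ U k (x 0%N).
Proof.
move=> H0; pose S w := (\sum_(0 <= k <oo) (hit_mass (U k) (N k - size w) w)%:E)%E.
have H0' : (S [::] < 1%:E)%E by rewrite /S; under eq_eseriesr do rewrite subn0.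
have m0 k w : (0 <= (hit_mass (U k) (N k - size w) w)%:E :> \bar R)%E.
  by rewrite lee_fin hit_mass_ge0.
have step w : exists a, (S w < 1%:E)%E ->
    a \in box (r (size w)) /\ (S (rcons w a) < 1%:E)%E.
  have [[a [ha1 ha2]]|h] := pselect (exists a, a \in box (r (size w)) /\ (S (rcons w a) < 1%:E)%E).
    by exists a.
  exists (0, 0)%N => Sw; exfalso.
  have r2 : 0 < (r (size w))%:R ^+ 2 :> R by rewrite exprn_gt0 ?r_gt0.
  suff : (((r (size w))%:R ^+ 2)%:E <= ((r (size w))%:R ^+ 2)%:E * S w)%E.
    rewrite -{1}[X in (X <= _)%E]mule1 lee_pmul2l //; first by rewrite leNgt Sw.
  rewrite -nneseriesZl; last by move=> k _; exact: m0.
  apply: (@le_trans _ _ (\sum_(a <- box (r (size w))) S (rcons w a))%E).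
    apply: (@le_trans _ _ (\sum_(a <- box (r (size w))) 1%:E)%E).
      by rewrite sumEFin sum_box_const mulr1.
    rewrite big_seq [leRHS]big_seq; apply: lee_sum => a aw.
    by rewrite leNgt; apply/negP => Sa; apply: h; exists a.
  rewrite /S -nneseries_sum; last by move=> a k _; exact: m0.
  apply: lee_nneseries => k _.
    by move=> _; apply: sume_ge0 => a _; exact: m0.
  by rewrite sumEFin -EFinM lee_fin hit_mass_average.
have [f hf] := choice step.
pose ws n := iter n (fun w => rcons w (f w)) [::].
have Sws n : (S (ws n) < 1%:E)%E /\ size (ws n) = n.
  elim: n => [|n [IH1 IH2]] //=; rewrite size_rcons IH2; split => //.
  by have [] := hf _ IH1.
pose d n := f (ws n).
have dws n : ws n = mkseq d n by elim: n => // n IH; rewrite mkseqS -IH.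
have dr n : d n \in box (r n).
  by have [h1 h2] := Sws n; have [] := hf _ h1; rewrite h2.
have [x fx] := @box_fraction_exists R r r4 d dr.
exists d, x; split => // k Ux.
have [+ sz] := Sws (N k); apply/negP; rewrite -leNgt /S sz.
apply: (@le_trans _ _ (hit_mass (U k) (N k - N k) (ws (N k)))%:E).
  rewrite subnn /= (_ : hits _ _) //; apply/asboolP; exists d, x; split => // i.
  by rewrite sz => ik; rewrite dws nth_mkseq.
rewrite -{1 4}sz; apply: (le_trans _ (nneseries_lim_ge k.+1 _)); last first.
  by move=> i _ _; rewrite lee_fin hit_mass_ge0.
rewrite big_nat_recr //= sz leeDr // sume_ge0 // => i _.
by rewrite lee_fin hit_mass_ge0.
Qed.

End BoxTree.

(** * Lower bound *)


Section LowerBound.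
Context {R : realType} (b c : R).
Hypotheses (b1 : 1 < b) (c1 : 1 < c).

Definition radius (n : nat) : nat := (Num.truncn (c `^ (b ^+ n.+1))).+4.

Lemma radius_ge4 n : (4 <= radius n)%N.
Proof. by []. Qed.

Lemma radius_ge n : c `^ (b ^+ n.+1) <= (radius n)%:R.
Proof.
apply: (le_trans (ltW (truncnS_gt _))).
have lt4 m : (m < m.+4)%N by lia.
by rewrite ler_nat; exact: lt4.
Qed.

Lemma ln_radius_ge n : b ^+ n.+1 * ln c <= ln (radius n)%:R.
Proof.
have c0 : 0 < c by rewrite (lt_trans _ c1).
by rewrite -ln_powR ler_ln ?posrE ?powR_gt0 // radius_ge.
Qed.

Lemma ln_radius_le n : ln (radius n)%:R <= b ^+ n.+1 * ln c + ln 5.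
Proof.
have c0 : 0 < c by rewrite (lt_trans _ c1).
have G0 : 0 < c `^ (b ^+ n.+1) by rewrite powR_gt0.
have G1 : 1 <= c `^ (b ^+ n.+1).
  rewrite -(powRr0 c); apply: ler_powR; first exact: ltW.
  by rewrite exprn_ge0 // (le_trans _ (ltW b1)).
rewrite -ln_powR -lnM ?posrE // ler_ln ?posrE ?mulr_gt0 //.
rewrite /radius -addn4 natrD.
have : (Num.truncn (c `^ (b ^+ n.+1)))%:R <= c `^ (b ^+ n.+1).
  by rewrite truncn_le ltW.
lra.
Qed.

Lemma sum_expn n : \sum_(i < n) b ^+ i.+1 = (b ^+ n.+1 - b) / (b - 1).
Proof.
have b0 : b - 1 != 0 by rewrite gt_eqF // subr_gt0.
elim: n => [|n IH]; first by rewrite big_ord0 expr1 subrr mul0r.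
by rewrite big_ord_recr /= IH [b ^+ n.+2]exprS; field.
Qed.

Lemma box_measure_bound (s : R) : 0 < s -> s < 2 / (1 + b) ->
  exists K : R, forall n,
    (9 / (box_scale radius n.+1 * (radius n)%:R)) `^ s *
      \prod_(l < n) ((radius l)%:R ^+ 2)^-1 <= K.
Proof.
move=> s0 sb; have b0 : 0 < b - 1 by rewrite subr_gt0.
have bp : 0 < 1 + b by rewrite addr_gt0 // (lt_trans _ b1).
have sb2 : 0 < 2 - s * (1 + b) by rewrite subr_gt0 -ltr_pdivlMr.
pose q := ln c; have q0 : 0 < q by rewrite ln_gt0.
pose g := q * (2 - s * (1 + b)) / (b - 1).
have g0 : 0 < g by rewrite divr_gt0 // mulr_gt0.
have [K0 HK0] := linear_le_expn (s * ln 16 / g) b1.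
exists (expR (s * ln 9 + s * ln 16 + s * ln 5 + s * q * b + g * b + g * K0)) => n.
pose l i : R := ln (radius i)%:R.
have r0 (i : nat) : 0 < (radius i)%:R :> R by exact: (r_gt0 radius_ge4).
have lE (i : nat) : (radius i)%:R = expR (l i) by rewrite lnK ?posrE.
have prodE : \prod_(i < n) ((radius i)%:R ^+ 2)^-1 = expR (- (2 * \sum_(i < n) l i)).
  rewrite mulr_sumr -sumrN expR_sum; apply: eq_bigr => i _.
  by rewrite expRN expRM_natl -lE.
have scaleE : box_scale radius n.+1 =
    expR (- ((n.+1)%:R * ln 16 + 2 * (\sum_(i < n) l i + l n))).
  rewrite /box_scale -(big_ord_recr n (op := +%R) (fun i => l i)).
  have -> : n.+1%:R * ln 16 = \sum_(i < n.+1) ln 16 :> R.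
    by rewrite sumr_const card_ord mulr_natl.
  rewrite mulr_sumr -big_split -sumrN expR_sum; apply: eq_bigr => i _ /=.
  by rewrite expRN expRD expRM_natl -lE lnK ?posrE.
have -> : 9 / (box_scale radius n.+1 * (radius n)%:R) =
    expR (ln 9 + (n.+1)%:R * ln 16 + 2 * \sum_(i < n) l i + l n).
  rewrite scaleE lE -expRD -expRN -[9](@lnK R) ?posrE // -expRD.
  by rewrite lnK ?posrE //; congr expR; ring.
rewrite /powR gt_eqF ?expR_gt0 // expRK prodE -expRD ler_expR.
have ln_le := ln_radius_le n; rewrite -/(l n) -/q in ln_le.
set S := \sum_(i < n) l i.
pose T := \sum_(i < n) b ^+ i.+1.
have ST : q * T <= S.
  by rewrite /T mulr_sumr; apply: ler_sum => i _; rewrite mulrC ln_radius_ge.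
have bT : b ^+ n.+1 = b + (b - 1) * T.
  rewrite /T sum_expn mulrC divfK ?gt_eqF //; ring.
have s1 : s < 1.
  by apply: (lt_trans sb); rewrite ltr_pdivrMr // mul1r; lra.
have hK : s * ln 16 * n%:R <= g * (b ^+ n.+1 + K0).
  have bn : b ^+ n <= b ^+ n.+1 by rewrite ler_eXn2l // ltW.
  have := HK0 n; rewrite mulrAC ler_pdivrMr // [_ * g]mulrC => /le_trans; apply.
  by rewrite ler_pM2l // lerD2r.
have gE : g * b ^+ n.+1 = g * b + q * (2 - s * (1 + b)) * T.
  rewrite bT /g; field; exact: lt0r_neq0.
have hS : (2 - 2 * s) * (q * T) <= (2 - 2 * s) * S by rewrite ler_wpM2l //; lra.
have hl := ler_wpM2l (ltW s0) ln_le.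
rewrite bT in hl; rewrite mulrDr gE in hK.
rewrite -[n.+1]addn1 natrD.
move: hS hl hK; move: (l n) S T (ln 16) (ln 9) (ln 5) n%:R K0 {HK0 ln_le ST bT gE prodE scaleE}.
move=> ln S' T' a1 a2 a3 m k0 hS hl hK.
nra.
Qed.

Lemma exists_gauge_radius (s e : R) (U : set R[i]) : 0 < s -> 0 < e ->
  (diam U <= 4^-1%:E)%E -> exists D : R,
  [/\ 0 < D, D < 3^-1, forall z z', U z -> U z' -> normc (z - z') <= D &
      ((D `^ s)%:E <= gauge s U + e%:E)%E].
Proof.
move=> s0 e0 dU.
pose t := Num.min 4^-1 (e `^ s^-1).
have t0 : 0 < t by rewrite lt_min invr_gt0 powR_gt0 // ltr0n.
have t4 : t <= 4^-1 by rewrite ge_min lexx.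
have ts : t `^ s <= e.
  rewrite -[leRHS]powRr1 ?(ltW e0) // -(mulVf (lt0r_neq0 s0)) powRrM.
  apply: ge0_ler_powR; rewrite ?nnegrE ?powR_ge0 ?(ltW t0) ?(ltW s0) //.
  by rewrite ge_min lexx orbT.
rewrite /gauge; case: ifPn => [/eqP U0|/set0P U0].
  exists t; split => //; first lra.
    by move=> z z'; rewrite U0.
  by rewrite add0e lee_fin.
have := diam_ge0 U0; case dE : (diam U) dU => [D||] // D4 D0.
rewrite !lee_fin in D4 D0.
have UD z z' : U z -> U z' -> normc (z - z') <= D.
  move=> Uz Uz'; rewrite -lee_fin -dE; apply: le_ereal_sup_tmp.
  by exists (normc (z - z'))%:E => //; exists z => //; exists z'.
rewrite poweR_EFin -EFinD.
have [tD|Dt] := leP t D.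
  exists D; split => //; [lra|lra|].
  by rewrite lee_fin lerDl ltW.
exists t; split => //; first lra.
  by move=> z z' Uz Uz'; apply: (le_trans (UD _ _ Uz Uz')); exact: ltW.
by rewrite lee_fin (le_trans ts) // lerDr powR_ge0.
Qed.

Lemma gauge_antimono (s s' : R) (U : set R[i]) : 0 <= s -> s <= s' -> 0 < s' ->
  (diam U <= 1%:E)%E -> (gauge s' U <= gauge s U)%E.
Proof.
move=> s0 ss s'0 d1; rewrite /gauge; case: ifPn => // /set0P U0.
have := diam_ge0 U0; case: (diam U) d1 => [D||] // D1 D0.
rewrite !poweR_EFin !lee_fin in D1 D0 *.
have [->|Dn0] := eqVneq D 0; first by rewrite powR0 ?gt_eqF // powR_ge0.
by apply: ger_powR => //; rewrite lt_neqAle eq_sym Dn0 D0.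
Qed.

Lemma hausdorff_measure_Xi_all (s : R) : 0 <= s -> s < 2 / (1 + b) ->
  hausdorff_measure s (Xi_all b c) <> 0%E.
Proof.
move=> s0 sb.
have quarter : 4^-1 + 4^-1 < 1 :> R by lra.
move=> H0; have bp : 0 < 1 + b by rewrite addr_gt0 // (lt_trans _ b1).
have b2 : 2 / (1 + b) < 1 by rewrite ltr_pdivrMr // mul1r (_ : 2 = 1 + 1) // ltrD2l.
pose s' := (s + 2 / (1 + b)) / 2.
have ss' : s < s' by rewrite /s'; lra.
have s'0 : 0 < s' by exact: le_lt_trans ss'.
have s'b : s' < 2 / (1 + b) by rewrite /s'; lra.
have [K0 HK0] := box_measure_bound s'0 s'b.
pose K := Num.max 1 K0.
have K1 : 1 <= K by rewrite le_max lexx.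
have K_gt0 : 0 < K by exact: lt_le_trans K1.
pose e := (4 * K)^-1.
have e0 : 0 < e by rewrite invr_gt0 mulr_gt0.
have d40 : 0 < 4^-1 :> R by rewrite invr_gt0.
have [U [[XU dU] sU]] := hausdorff_measure0_cover d40 e0 H0.
have ek0 k : 0 < e / (2 ^ k.+1)%:R by rewrite divr_gt0 // ltr0n expn_gt0.
have hit k : exists N, ((hit_mass radius (U k) N [::])%:E <=
    K%:E * (gauge s (U k) + (e / (2 ^ k.+1)%:R)%:E))%E.
  have [D [D0 D3 UD Dg]] := exists_gauge_radius s'0 (ek0 k) (dU k).
  have s2 : 0 < s' <= 2 by rewrite s'0 (le_trans (ltW (lt_trans s'b b2))) // ler1n.
  have [N hN] := exists_hit_mass_le radius_ge4 s2 D0 D3 UD HK0.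
  exists N; apply: (@le_trans _ _ (K%:E * (D `^ s')%:E)%E).
    rewrite -EFinM lee_fin; apply: (le_trans hN).
    by rewrite ler_wpM2r ?powR_ge0 // le_max lexx orbT.
  rewrite lee_pmul2l //; apply: (le_trans Dg); rewrite leeD2r //.
  apply: gauge_antimono; rewrite ?(ltW ss') //.
  by apply: (le_trans (dU k)); rewrite lee_fin invf_le1 // ler1n.
have [N HN] := choice hit.
have [|d [x [fx Ux]]] := @exists_box_fraction_avoiding R radius radius_ge4 U N.
  apply: (@le_lt_trans _ _ (K%:E * (e + e)%:E)%E); last first.
    have Ke : K * e = 4^-1 by rewrite /e invfM mulrCA divff ?mulr1 // gt_eqF.
    by rewrite -EFinM lte_fin mulrDr Ke.
  apply: (le_trans (lee_nneseries _ (fun k _ => HN k))) => [k _ _|].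
    by rewrite lee_fin hit_mass_ge0.
  rewrite nneseriesZl => [|k _]; last first.
    by rewrite adde_ge0 ?gauge_ge0 // lee_fin ltW.
  rewrite lee_pmul2l //; apply: (le_trans (epsilon_trick _ _ _)).
  - by move=> k; exact: gauge_ge0.
  - exact: ltW.
  by rewrite EFinD leeD2r // ltW.
have : (\bigcup_k U k) (x 0%N) by apply: XU; apply: (box_fraction_Xi_all radius_ge4 _ fx); exact: radius_ge.
by move=> [k _ /Ux].
Qed.

End LowerBound.

Lemma Xi_all_sub_Xi_io (R : realType) (b c : R) : Xi_all b c `<=` Xi_io b c.
Proof.
move=> z [Fz hz]; split => //.
apply: sub_infinite_set (infinite_setD infinite_nat (finite_set1 0%N)).
move=> [[_ []//]|n _]; by split => //; exact: hz.
Qed.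

Theorem theorem1p4 (R : realType) (b c : R) (hb : 1 < b) (hc : 1 < c) :
  hausdorff_dim (Xi_all b c) = (2 / (1 + b))%:E /\
  hausdorff_dim (Xi_io b c) = (2 / (1 + b))%:E.
Proof.
have d0 : 0 < 2 / (1 + b) by rewrite divr_gt0 // addr_gt0 // (lt_trans _ hb).
have dim_le (A : set R[i]) : A `<=` Xi_io b c ->
    (hausdorff_dim A <= (2 / (1 + b))%:E)%E.
  move=> AX; apply/lee_addgt0Pr => e e0; rewrite -EFinD.
  have s0 : 0 < 2 / (1 + b) + e by rewrite addr_gt0.
  apply: ge_ereal_inf; exists (2 / (1 + b) + e)%:E => //.
  exists (2 / (1 + b) + e) => //; split; first exact: ltW.
  apply: hausdorff_measure_eq0_sub AX _; first exact: ltW.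
  by apply: hausdorff_measure_Xi_io => //; rewrite ltrDl.
have dim_ge (A : set R[i]) : Xi_all b c `<=` A ->
    ((2 / (1 + b))%:E <= hausdorff_dim A)%E.
  move=> XA; apply/ereal_infP => _ [s [s0 HA] <-]; rewrite lee_fin leNgt.
  apply/negP => sb; apply: (hausdorff_measure_Xi_all hb hc s0 sb).
  exact: hausdorff_measure_eq0_sub XA HA.
have XX := @Xi_all_sub_Xi_io R b c.
by split; apply/eqP; rewrite eq_le dim_le // dim_ge.
Qed.
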